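(* If $(a_1,b_1)$ and $(a_2,b_2)$ are bi-Boolean independent pairs in a non-commutative probability space $(\mathcal{A},\varphi)$, then $$\widetilde\eta_{((1+a_1)(1+a_2),\,b_1+b_2)}(z,w)=\widetilde\eta_{(1+a_1,b_1)}(z,w)+\frac1z\,\eta_{1+a_1}(z)\cdot\widetilde\eta_{(1+a_2,b_2)}(z,w)$$ and $$\widetilde\eta_{(a_1+a_2,\,(1+b_2)(1+b_1))}(z,w)=\widetilde\eta_{(a_2,1+b_2)}(z,w)+\frac1w\,\eta_{1+b_2}(w)\cdot\widetilde\eta_{(a_1,1+b_1)}(z,w).$$
   Context: All series are formal power series in commuting variables $z,w$. A non-commutative probability space $(\mathcal{A},\varphi)$ is a unital complex algebra with a unital linear functional $\varphi$. For $\chi:\{1,\dots,n\}\to\{\ell,r\}$ with $\chi^{-1}(\{\ell\})=\{i_1<\cdots<i_p\}$ and $\chi^{-1}(\{r\})=\{i_{p+1}>\cdots>i_n\}$, let $\prec_\chi$ be the total order $i_1\prec_\chi\cdots\prec_\chi i_n$; a $\chi$-interval is an interval for $\prec_\chi$. $\mathrm{BI}(\chi)$ is the set of partitions of $\{1,\dots,n\}$ all of whose blocks are $\chi$-intervals. For $V=\{v_1<\cdots<v_s\}$ put $(x_1,\dots,x_n)|_V=(x_{v_1},\dots,x_{v_s})$, and regard $\chi|_V$ as a map on $\{1,\dots,s\}$ via $v_i\leftrightarrow i$. The B-$(\ell,r)$-cumulants are the unique multilinear functionals $B_\chi:\mathcal{A}^n\to\mathbb{C}$ with $\varphi(x_1\cdots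 x_n)=\sum_{\pi\in\mathrm{BI}(\chi)}\prod_{V\in\pi}B_{\chi|_V}((x_1,\dots,x_n)|_V)$ for all $n\ge1$, $\chi$, $x_1,\dots,x_n$. $\chi_{m,n}:\{1,\dots,m+n\}\to\{\ell,r\}$ is $\ell$ on $\{1,\dots,m\}$ and $r$ on $\{m+1,\dots,m+n\}$; $B_{m,n}(x,y)=B_{\chi_{m,n}}(x,\dots,x,y,\dots,y)$ ($m$ copies of $x$, then $n$ copies of $y$); $B_m(x)=B_\chi(x,\dots,x)$ for constant $\chi:\{1,\dots,m\}\to\{\ell,r\}$. The Boolean $\eta$-transform is $\eta_x(z)=\sum_{m\ge1}B_m(x)z^m$, and the reduced bi-Boolean partial $\eta$-transform is $\widetilde\eta_{(x,y)}(z,w)=\sum_{m,n\ge1}B_{m,n}(x,y)z^mw^n$. For $\omega:\{1,\dots,n\}\to K$, $\pi_{\omega,\chi}$ is the unique maximal partition of $\{1,\dots,n\}$ whose blocks are $\chi$-intervals on each of which $\omega$ is constant. For a partition $\pi$, $\varphi_\pi(x_1,\dots,x_n)=\prod_{V=\{v_1<\cdots<v_s\}\in\pi}\varphi(x_{v_1}\cdots x_{v_s})$. A family $\{(\mathcal{A}_{k,\ell},\mathcal{A}_{k,r})\}_{k\in K}$ of pairs of (not required to be unital) subalgebras is bi-Boolean independent if $\varphi(x_1\cdots x_n)=\varphi_{\pi_{\omega,\chi}}(x_1,\dots,x_n)$ for all $n\ge1$, $\chi$, $\omega$, and $x_j\in\mathcal{A}_{\omega(j),\chi(j)}$. Pairs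 $(a_1,b_1),(a_2,b_2)$ are bi-Boolean independent if the pairs of non-unital algebras $(\mathrm{alg}(a_k),\mathrm{alg}(b_k))$, $k=1,2$, generated by $a_k$ (left) and $b_k$ (right), are. *)

(* Defs.v *)
From HB Require Import structures.
From mathcomp Require Import boolp classical_sets reals.
From mathcomp Require Import all_boot all_order all_algebra.
From mathcomp Require Export complex.

Set Implicit Arguments.
Unset Strict Implicit.
Unset Printing Implicit Defensive.

Import GRing.Theory.
Local Open Scope ring_scope.

Inductive side := Left | Right.

(* Positions 1, ..., n are represented by the ordinals 0, ..., n-1 of 'I_n. *)

Definition chi_lt n (chi : 'I_n -> side) (i j : 'I_n) : bool :=
  match chi i, chi j with
  | Left, Left => (i < j)%N
  | Left, Right => true
  | Right, Left => false
  | Right, Right => (j < i)%N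
  end.

Definition chi_interval n (chi : 'I_n -> side) (V : {set 'I_n}) : bool :=
  [forall i in V, forall k in V, forall j,
     chi_lt chi i j && chi_lt chi j k ==> (j \in V)].

Definition BI n (chi : 'I_n -> side) : {set {set {set 'I_n}}} :=
  [set pi : {set {set 'I_n}} |
     partition pi [set: 'I_n] && [forall V in pi, chi_interval chi V]].

(* Since [enum V] is increasing, [restr f V] is (f v_1, ..., f v_s) for
   V = {v_1 < ... < v_s}. *)
Definition restr n T (f : 'I_n -> T) (V : {set 'I_n}) : 'I_#|V| -> T :=
  fun i => f (enum_val i).
Arguments restr {n T} f V.

Definition upd n T (x : 'I_n -> T) (i : 'I_n) (u : T) : 'I_n -> T :=
  fun j => if j == i then u else x j.

Definition functionals (C A : Type) :=
  forall n, ('I_n -> side) -> ('I_n -> A) -> C.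

Definition multilinear (R : realType) (A : algType R[i])
    (B : functionals R[i] A) : Prop :=
  forall n (chi : 'I_n -> side) (x : 'I_n -> A) (i : 'I_n) (c : R[i])
         (u v : A),
    B n chi (upd x i (c *: u + v)) =
    c * B n chi (upd x i u) + B n chi (upd x i v).

Definition moment_cumulant (R : realType) (A : algType R[i])
    (phi : {scalar A}) (B : functionals R[i] A) : Prop :=
  forall n (chi : 'I_n -> side) (x : 'I_n -> A), (0 < n)%N ->
    phi (\prod_(i < n) x i) =
    \sum_(pi in BI chi) \prod_(V in pi) B #|V| (restr chi V) (restr x V).

Definition is_bcumulant (R : realType) (A : algType R[i])
    (phi : {scalar A}) (B : functionals R[i] A) : Prop :=
  multilinear B /\ moment_cumulant phi B.

Fixpoint bcum_rec (R : realType) (A : algType R[i]) (phi : {scalar A})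
    (k : nat) : functionals R[i] A :=
  fun n chi x =>
  if k is k'.+1 then
    phi (\prod_(i < n) x i) -
    \sum_(pi in BI chi | pi != [set [set: 'I_n]])
       \prod_(V in pi) bcum_rec phi k' (restr chi V) (restr x V)
  else 0.
Arguments bcum_rec {R A} phi k n chi x.

Lemma partition_setT n (pi : {set {set 'I_n}}) :
  partition pi [set: 'I_n] -> [set: 'I_n] \in pi -> pi = [set [set: 'I_n]].
Proof.
case/and3P=> _ /trivIsetP tr n0 piT; apply/setP=> V; rewrite inE.
apply/idP/eqP=> [Vpi|->//]; apply: contraTeq isT => VT.
have := tr _ _ Vpi piT VT.
by rewrite -setI_eq0 finset.setIT => /eqP V0; rewrite V0 (negbTE n0) in Vpi.
Qed.

Lemma BI_setT n (chi : 'I_n -> side) :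
  (0 < n)%N -> [set [set: 'I_n]] \in BI chi.
Proof.
move=> n0; rewrite inE; apply/andP; split.
  rewrite /partition /cover big_set1 eqxx trivIset1 inE /=.
  by rewrite eq_sym -card_gt0 cardsT card_ord.
apply/forall_inP=> V; rewrite inE => /eqP ->.
apply/forall_inP=> i _; apply/forall_inP=> k _; apply/forallP=> j.
by rewrite inE implybT.
Qed.

Lemma BI_block_gt0 n (chi : 'I_n -> side) pi V :
  pi \in BI chi -> V \in pi -> (0 < #|V|)%N.
Proof.
rewrite inE => /andP[/and3P[_ _ n0] _] Vpi.
by rewrite card_gt0; apply: contraNneq n0 => <-.
Qed.

Lemma BI_block_lt n (chi : 'I_n -> side) pi V :
  pi \in BI chi -> pi != [set [set: 'I_n]] -> V \in pi -> (#|V| < n)%N.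
Proof.
rewrite inE => /andP[pp _] piN Vpi.
have le : (#|V| <= n)%N by have := max_card (mem V); rewrite card_ord.
rewrite ltn_neqAle le andbT.
apply: contra piN => /eqP cV; apply/eqP/partition_setT => //.
suff <- : V = [set: 'I_n]%SET by [].
by apply/eqP; rewrite eqEcard finset.subsetT cardsT card_ord cV leqnn.
Qed.

Lemma restr_setT n T T' U (B : forall n, ('I_n -> T) -> ('I_n -> T') -> U)
    (chi : 'I_n -> T) (x : 'I_n -> T') :
  B #|[set: 'I_n]| (restr chi [set: 'I_n]) (restr x [set: 'I_n]) = B n chi x.
Proof.
have H m (f : 'I_m -> 'I_n) : m = n -> (forall i, f i = i :> nat) ->
    B m (fun i => chi (f i)) (fun i => x (f i)) = B n chi x.
  move=> mn; subst m => fE.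
  by congr (B n _ _); apply/funext=> i; congr (_ _); apply/val_inj/fE.
apply: H => [|i]; first by rewrite cardsT card_ord.
have [j ->] : exists j, i = j by exists i.
have jn : (j < n)%N by rewrite -[X in (_ < X)%N]card_ord -cardsT.
rewrite (enum_val_nth (Ordinal jn)) /=.
by rewrite enum_setT -enumT nth_enum_ord.
Qed.

Lemma bcum_rec_stable (R : realType) (A : algType R[i]) (phi : {scalar A}) k1 k2
    n (chi : 'I_n -> side) (x : 'I_n -> A) :
  (0 < n <= k1)%N -> (n <= k2)%N ->
  bcum_rec phi k1 n chi x = bcum_rec phi k2 n chi x.
Proof.
elim: k1 k2 n chi x => [|k1 IH] [|k2] n chi x /andP[n0 nk1] nk2;
  try by have := leq_trans n0 nk1.
  by have := leq_trans n0 nk2.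
rewrite /=; apply: (congr1 (fun s => _ - s)); apply: eq_bigr => pi /andP[piB piN].
apply: eq_bigr => V Vpi; have lt := BI_block_lt piB piN Vpi.
apply: IH; last by rewrite -ltnS (leq_trans lt).
by rewrite (BI_block_gt0 piB Vpi) -ltnS (leq_trans lt).
Qed.

Lemma prod_upd (R : realType) (A : algType R[i]) n (x : 'I_n -> A) (i : 'I_n) :
  exists p q, forall u, \prod_(j < n) upd x i u j = p * u * q.
Proof.
have := index_enum_uniq 'I_n.
case/splitPr: (mem_index_enum i) => s1 s2.
rewrite cat_uniq /= negb_or => /and3P[_ /andP[is1 _] /andP[is2 _]].
exists (\prod_(j <- s1) x j), (\prod_(j <- s2) x j) => u.
rewrite big_cat big_cons /= {2}/upd eqxx mulrA; congr (_ * _ * _).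
  rewrite !big_seq; apply: eq_bigr => j js1; rewrite /upd.
  by case: eqP => // ji; rewrite -ji js1 in is1.
rewrite !big_seq; apply: eq_bigr => j js2; rewrite /upd.
by case: eqP => // ji; rewrite -ji js2 in is2.
Qed.

Lemma restr_upd_notin n T (x : 'I_n -> T) i u (V : {set 'I_n}) :
  i \notin V -> restr (upd x i u) V = restr x V.
Proof.
move=> iV; apply/funext=> j; rewrite /restr /upd.
by case: eqP => // ji; rewrite -ji enum_valP in iV.
Qed.

Lemma restr_upd_in n T (x : 'I_n -> T) i (V : {set 'I_n}) (iV : i \in V) u :
  restr (upd x i u) V = upd (restr x V) (enum_rank_in iV i) u.
Proof.
apply/funext=> j; rewrite /restr /upd.
suff -> : (enum_val j == i) = (j == enum_rank_in iV i) by [].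
apply/eqP/eqP => [ji|->].
  by apply: enum_val_inj; rewrite enum_rankK_in.
by rewrite enum_rankK_in.
Qed.

Lemma bcum_rec_multilinear (R : realType) (A : algType R[i])
    (phi : {scalar A}) k : multilinear (bcum_rec phi k).
Proof.
elim: k => [|k IH] n chi x i c u v /=; first by rewrite mulr0 addr0.
have [p [q pq]] := prod_upd x i.
rewrite !pq mulrDr mulrDl -scalerAr -scalerAl linearP /= mulrBr.
rewrite [RHS]addrACA; congr (_ + _); rewrite -opprD; congr (- _).
rewrite mulr_sumr -big_split /=; apply: eq_bigr => pi /andP[piB _].
have piP : partition pi [set: 'I_n]%SET by move: piB; rewrite inE => /andP[].
have [V Vpi iV] : exists2 V, V \in pi & i \in V.
  have : i \in cover pi by rewrite (cover_partition piP) inE.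
  by case/bigcupP=> V; exists V.
have tr : trivIset pi by case/and3P : piP.
rewrite !(bigD1 V Vpi) /= !(restr_upd_in _ iV) IH.
have E w : \prod_(W in pi | W != V)
      bcum_rec phi k #|W| (restr chi W) (restr (upd x i w) W) =
    \prod_(W in pi | W != V) bcum_rec phi k #|W| (restr chi W) (restr x W).
  apply: eq_bigr => W /andP[Wpi WV]; rewrite restr_upd_notin//.
  apply/negP=> iW; move/trivIsetP : tr => /(_ _ _ Wpi Vpi WV).
  by rewrite disjoints_subset => /subsetP/(_ _ iW); rewrite inE iV.
by rewrite !E mulrDl mulrA.
Qed.

Lemma bcumulant_exists (R : realType) (A : algType R[i]) (phi : {scalar A}) :
  exists B, is_bcumulant phi B.
Proof.
exists (fun n => bcum_rec phi n n); split=> [n|n chi x n0].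
  exact: bcum_rec_multilinear.
rewrite (bigD1 [set [set: 'I_n]]%SET) ?BI_setT//= big_set1.
rewrite (restr_setT (fun n => bcum_rec phi n n)).
case: n chi x n0 => // n chi x _ /=; rewrite -addrA [X in _ + X](_ : _ = 0) ?addr0//.
apply/eqP; rewrite addrC subr_eq0; apply/eqP.
apply: eq_bigr => pi /andP[piB piN]; apply: eq_bigr => V Vpi.
have lt := BI_block_lt piB piN Vpi.
by apply: bcum_rec_stable; rewrite ?(BI_block_gt0 piB Vpi)/=.
Qed.

Lemma bcumulant_unique (R : realType) (A : algType R[i]) (phi : {scalar A})
    (B B' : functionals R[i] A) :
  is_bcumulant phi B -> is_bcumulant phi B' ->
  forall n (chi : 'I_n -> side) (x : 'I_n -> A), (0 < n)%N ->
    B n chi x = B' n chi x.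
Proof.
move=> [_ PB] [_ PB'] n; have [k] := ubnP n.
elim: k n => // k IH n; rewrite ltnS => nk chi x n0.
have := PB n chi x n0; rewrite (PB' n chi x n0).
rewrite !(bigD1 (P := fun pi => pi \in BI chi) _ (BI_setT chi n0))/=.
rewrite !big_set1 !restr_setT => /esym/eqP.
rewrite [X in _ + X == _](eq_bigr (fun pi : {set {set 'I_n}} =>
    \prod_(V in pi) B' #|V| (restr chi V) (restr x V))).
  by move/eqP/addIr.
move=> pi /andP[piB piN]; apply: eq_bigr => V Vpi; apply: IH.
  by rewrite (leq_trans (BI_block_lt piB piN Vpi)).
exact: BI_block_gt0 piB Vpi.
Qed.

Definition bcumulant (R : realType) (A : algType R[i]) (phi : {scalar A}) :
  functionals R[i] A := sval (cid (bcumulant_exists phi)).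
Arguments bcumulant {R A} phi n chi x.

Lemma bcumulantP (R : realType) (A : algType R[i]) (phi : {scalar A}) :
  is_bcumulant phi (bcumulant phi).
Proof. exact: svalP (cid (bcumulant_exists phi)). Qed.

Definition bcumulant_mn (R : realType) (A : algType R[i]) (phi : {scalar A})
    (m n : nat) (x y : A) : R[i] :=
  bcumulant phi (m + n) (fun i : 'I_(m + n) => if (i < m)%N then Left else Right)
                (fun i => if (i < m)%N then x else y).

(* The constant map chi is taken to be Left; by [bcumulant_constE] the other
   constant map gives the same value. *)
Definition bcumulant_m (R : realType) (A : algType R[i]) (phi : {scalar A})
    (m : nat) (x : A) : R[i] :=
  bcumulant phi m (fun _ : 'I_m => Left) (fun _ => x).

Lemma BI_const n : BI (fun _ : 'I_n => Right) = BI (fun _ : 'I_n => Left).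
Proof.
have sw V : chi_interval (fun _ : 'I_n => Right) V
          = chi_interval (fun _ : 'I_n => Left) V.
  by apply/forall_inP/forall_inP=> H i iV; apply/forall_inP=> k kV;
     apply/forallP=> j; move/forall_inP/(_ i iV)/forallP/(_ j) : (H k kV);
     rewrite /chi_lt andbC.
apply/setP=> pi; rewrite !inE; congr (_ && _).
by apply: eq_forallb => V; rewrite sw.
Qed.

Lemma bcumulant_constE (R : realType) (A : algType R[i]) (phi : {scalar A})
    n (x : 'I_n -> A) : (0 < n)%N ->
  bcumulant phi n (fun _ : 'I_n => Right) x =
  bcumulant phi n (fun _ : 'I_n => Left) x.
Proof.
have [_ PB] := bcumulantP phi; have [k] := ubnP n.
elim: k n x => // k IH n x; rewrite ltnS => nk n0.
have := PB n (fun=> Right) x n0; rewrite (PB n (fun=> Left) x n0) BI_const.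
rewrite !(bigD1 (P := fun pi => pi \in BI _) _ (BI_setT (fun=> Left) n0))/=.
rewrite !big_set1 !restr_setT => /esym/eqP.
rewrite [X in _ + X == _](eq_bigr (fun pi : {set {set 'I_n}} => \prod_(V in pi)
  bcumulant phi #|V| (restr (fun=> Left) V) (restr x V))).
  by move/eqP/addIr.
move=> pi /andP[piB piN]; apply: eq_bigr => V Vpi; apply: IH.
  by rewrite (leq_trans (BI_block_lt piB piN Vpi)).
exact: BI_block_gt0 piB Vpi.
Qed.

(* Formal power series in commuting variables z, w:
   [f m n] is the coefficient of z^m w^n. *)

Definition ps (C : Type) := nat -> nat -> C.

Definition psD (C : nzRingType) (f g : ps C) : ps C :=
  fun m n => f m n + g m n.

Definition psM (C : nzRingType) (f g : ps C) : ps C :=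
  fun m n => \sum_(i < m.+1) \sum_(j < n.+1) f i j * g (m - i)%N (n - j)%N.

(* A one-variable series, read in the variable z (resp. w). *)
Definition ps_in_z (C : nzRingType) (f : nat -> C) : ps C :=
  fun m n => if n == 0%N then f m else 0.

Definition ps_in_w (C : nzRingType) (f : nat -> C) : ps C :=
  fun m n => if m == 0%N then f n else 0.

Definition psz (C : nzRingType) : ps C :=
  fun m n => ((m == 1%N) && (n == 0%N))%:R.

Definition psw (C : nzRingType) : ps C :=
  fun m n => ((m == 0%N) && (n == 1%N))%:R.

(* (1/z) f and (1/w) f, meaningful for series divisible by z (resp. w), as
   justified by [psdivzK] and [psdivwK]. *)
Definition psdivz (C : nzRingType) (f : ps C) : ps C := fun m n => f m.+1 n.

Definition psdivw (C : nzRingType) (f : ps C) : ps C := fun m n => f m n.+1.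

Lemma psdivzK (C : nzRingType) (f : ps C) :
  (forall n, f 0%N n = 0) -> psM (psz C) (psdivz f) = f.
Proof.
move=> f0; apply/funext=> m; apply/funext=> n; rewrite /psM /psz.
case: m => [|m].
  by rewrite big_ord1 f0 big1// => j _; rewrite mul0r.
rewrite big_ord_recl big1 => [|j _]; last by rewrite mul0r.
rewrite add0r big_ord_recl /= big_ord_recl /= !subn0 big1 => [|j _];
  last by rewrite mul0r.
rewrite addr0 big1 => [|j _]; last by rewrite big1// => l _; rewrite mul0r.
by rewrite addr0 mul1r /psdivz /bump /= subn1.
Qed.

Lemma psdivwK (C : nzRingType) (f : ps C) :
  (forall m, f m 0%N = 0) -> psM (psw C) (psdivw f) = f.
Proof.
move=> f0; apply/funext=> m; apply/funext=> n; rewrite /psM /psw.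
rewrite big_ord_recl [X in _ + X]big1 => [|j _];
  last by rewrite big1// => l _; rewrite mul0r.
rewrite addr0 subn0; case: n => [|n].
  by rewrite big_ord1 mul0r f0.
rewrite big_ord_recl mul0r add0r big_ord_recl big1 => [|j _]; last by rewrite mul0r.
by rewrite addr0 mul1r /psdivw /bump /= subn1.
Qed.

Definition eta (R : realType) (A : algType R[i]) (phi : {scalar A}) (x : A) :
    nat -> R[i] :=
  fun m => if (0 < m)%N then bcumulant_m phi m x else 0.

Definition reduced_eta (R : realType) (A : algType R[i]) (phi : {scalar A})
    (x y : A) : ps R[i] :=
  fun m n => if (0 < m)%N && (0 < n)%N then bcumulant_mn phi m n x y else 0.

Definition constant_on n (K : eqType) (omega : 'I_n -> K) (V : {set 'I_n}) :
    bool :=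
  [forall i in V, forall j in V, omega i == omega j].

Definition mono_BI n (K : eqType) (omega : 'I_n -> K) (chi : 'I_n -> side) :
    {set {set {set 'I_n}}} :=
  [set pi in BI chi | [forall V in pi, constant_on omega V]].

Definition refines n (sigma pi : {set {set 'I_n}}) : bool :=
  [forall V in sigma, exists W in pi, V \subset W].

Definition is_max_mono_BI n (K : eqType) (omega : 'I_n -> K)
    (chi : 'I_n -> side) (pi : {set {set 'I_n}}) : bool :=
  (pi \in mono_BI omega chi) &&
  [forall sigma in mono_BI omega chi, refines pi sigma ==> (sigma == pi)].

(* The default value is never used: [max_mono_BI_unique] shows that exactly one
   partition is maximal. *)
Definition max_mono_BI n (K : eqType) (omega : 'I_n -> K)
    (chi : 'I_n -> side) : {set {set 'I_n}} :=
  odflt finset.set0 [pick pi | is_max_mono_BI omega chi pi].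

Definition chi_key n (chi : 'I_n -> side) (i : 'I_n) : nat :=
  if chi i is Left then i else (n + (n - i))%N.

Lemma chi_ltE n (chi : 'I_n -> side) i j :
  chi_lt chi i j = (chi_key chi i < chi_key chi j)%N.
Proof.
rewrite /chi_lt /chi_key; case: (chi i) (chi j) => [] [] //.
- by apply/esym; rewrite (leq_trans (ltn_ord i))// leq_addr.
- by apply/esym/negbTE; rewrite -leqNgt (leq_trans (ltnW (ltn_ord j)))// leq_addr.
- by rewrite ltn_add2l ltn_sub2lE// ltnW.
Qed.

Lemma refines_anti n (sigma pi : {set {set 'I_n}}) :
  partition sigma [set: 'I_n] -> partition pi [set: 'I_n] ->
  refines sigma pi -> refines pi sigma -> sigma = pi.
Proof.
move=> Ps Pp sp ps; apply/eqP; rewrite eqEsubset; apply/andP.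
suff H (s p : {set {set 'I_n}}) : partition s [set: 'I_n]%SET ->
    refines s p -> refines p s -> s \subset p by split; apply: H.
case/and3P=> _ /trivIsetP tr s0 sp' ps'; apply/subsetP=> V Vs.
have /existsP[W /andP[Wp VW]] := forall_inP sp' _ Vs.
have /existsP[V' /andP[V's WV']] := forall_inP ps' _ Wp.
have VV' : V = V'.
  apply: contraTeq isT => /(tr _ _ Vs V's).
  rewrite -setI_eq0 (setIidPl (subset_trans VW WV')) => /eqP V0.
  by rewrite -V0 Vs in s0.
suff -> : V = W by [].
by apply/eqP; rewrite eqEsubset VW VV'.
Qed.

Lemma max_mono_BI_greatest n (K : eqType) (omega : 'I_n -> K)
    (chi : 'I_n -> side) :
  exists2 pi, pi \in mono_BI omega chi &
    forall sigma, sigma \in mono_BI omega chi -> refines sigma pi.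
Proof.
pose key := chi_key chi.
have key_inj : injective key.
  move=> i j; have := chi_ltE chi i j; have := chi_ltE chi j i.
  rewrite -/key => + + E; rewrite E ltnn /chi_lt.
  case: (chi i) (chi j) => [] [] // /negbT; rewrite -leqNgt => ij /negbT;
    by rewrite -leqNgt => ji; apply/val_inj/eqP; rewrite eqn_leq ij ji.
pose btw i j k := ((key i <= key k) && (key k <= key j))%N.
pose r := [rel i j : 'I_n | [forall k, btw i j k || btw j i k ==>
   (omega k == omega i)] && (omega i == omega j)].
have rP i j : reflect ((forall k, btw i j k || btw j i k -> omega k = omega i)
    /\ omega i = omega j) (r i j).
  apply: (iffP andP) => -[H /eqP E]; split=> //.
  - by move=> k bk; apply/eqP; move/forallP/(_ k)/implyP : H; apply.
  - by apply/forallP=> k; apply/implyP=> bk; apply/eqP/H.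
have btwW i j k l : btw i k l || btw k i l ->
  (btw i j l || btw j i l) || (btw j k l || btw k j l).
  rewrite /btw; case: (leqP (key l) (key j)) => lj; rewrite ?andbT ?andbF ?orbF.
    by case/orP=> /andP[-> ?]; rewrite ?orbT.
  by rewrite (ltnW lj) /= => /orP[] /andP[_ ->]; rewrite ?orbT.
have rsym i j : r i j -> r j i.
  move=> /rP[H E]; apply/rP; split=> // k bk.
  by rewrite -E; apply: H; rewrite orbC.
have rtr i j k : r i j -> r j k -> r i k.
  move=> /rP[H1 E1] /rP[H2 E2]; apply/rP; split; last by rewrite E1.
  by move=> l /(@btwW i j k l)/orP[/H1//|/H2]; rewrite E1.
have rr i : r i i.
  apply/rP; split=> // k; rewrite orbb /btw -eqn_leq => /eqP.
  by move=> /key_inj ->.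
have eqr : {in [set: 'I_n]%SET & &, equivalence_rel r}.
  move=> i j k _ _ _; split=> [|ij]; first exact: rr.
  apply/idP/idP => [ik|jk]; first exact: rtr (rsym _ _ ij) ik.
  exact: rtr ij jk.
pose pi := equivalence_partition r [set: 'I_n]%SET.
have piP : partition pi [set: 'I_n]%SET := equivalence_partitionP eqr.
have blk V i j : V \in pi -> i \in V -> (j \in V) = r i j.
  case/imsetP=> k _ ->; rewrite !inE /= => ki; apply/idP/idP => [kj|ij].
    exact: rtr (rsym _ _ ki) kj.
  exact: rtr ki ij.
have Vpi i : exists2 V, V \in pi & i \in V.
  have : i \in cover pi by rewrite (cover_partition piP) inE.
  by case/bigcupP=> V; exists V.
exists pi.
  rewrite !inE piP /=; apply/andP; split; apply/forall_inP=> V Vp.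
    apply/forall_inP=> i iV; apply/forall_inP=> k kV; apply/forallP=> j.
    apply/implyP; rewrite !chi_ltE -/key => /andP[ij jk].
    move: kV; rewrite !(blk _ _ _ Vp iV) => /rP[H E]; apply/rP.
    have Hj : omega j = omega i by apply: H; rewrite /btw (ltnW ij) (ltnW jk).
    split=> // l bl; apply: H.
    move: bl; rewrite /btw => /orP[/andP[-> lj]|/andP[jl li]].
      by rewrite (leq_trans lj (ltnW jk)).
    by have := leq_trans jl li; rewrite leqNgt ij.
  apply/forall_inP=> i iV; apply/forall_inP=> j; rewrite (blk _ _ _ Vp iV).
  by case/andP.
move=> sigma; rewrite inE [sigma \in BI _]inE => /andP[/andP[sP sI] sC].
apply/forall_inP=> V Vs.
have /set0Pn[i iV] : V != finset.set0.
  by case/and3P: sP => _ _; apply: contraNneq => <-.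
have [W Wpi iW] := Vpi i; apply/existsP; exists W; rewrite Wpi /=.
apply/subsetP=> j jV; rewrite (blk _ _ _ Wpi iW); apply/rP.
have C k : k \in V -> omega k = omega i.
  move=> kV; apply/eqP.
  by move/forall_inP/(_ _ Vs)/forall_inP/(_ _ kV)/forall_inP/(_ _ iV) : sC.
split=> [k bk|]; last exact/esym/C.
have I a b : a \in V -> b \in V -> btw a b k -> k \in V.
  move=> aV bV; rewrite /btw leq_eqVlt => /andP[/orP[/eqP/key_inj<-//|ak]].
  rewrite leq_eqVlt => /orP[/eqP/key_inj->//|kb].
  move/forall_inP/(_ _ Vs)/forall_inP/(_ _ aV)/forall_inP/(_ _ bV) : sI.
  by move=> /forallP/(_ k)/implyP; apply; rewrite !chi_ltE -/key ak kb.
by apply: C; case/orP: bk; apply: I.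
Qed.

Lemma max_mono_BI_unique n (K : eqType) (omega : 'I_n -> K)
    (chi : 'I_n -> side) (pi : {set {set 'I_n}}) :
  is_max_mono_BI omega chi pi = (pi == max_mono_BI omega chi).
Proof.
have [rho rhoB rhoG] := max_mono_BI_greatest omega chi.
have part (s : {set {set 'I_n}}) : s \in mono_BI omega chi -> partition s [set: 'I_n]%SET.
  by rewrite inE [_ \in BI _]inE => /andP[/andP[]].
have E s : is_max_mono_BI omega chi s = (s == rho).
  apply/andP/eqP => [[sB /forall_inP/(_ _ rhoB)/implyP/(_ (rhoG _ sB))/eqP ->]//|->].
  split; first exact: rhoB.
  apply/forall_inP=> t tB; apply/implyP=> rt; apply/eqP.
  by apply: refines_anti; rewrite ?part ?rhoG.
rewrite E /max_mono_BI; case: pickP => [t|/(_ rho)]; rewrite E ?eqxx//.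
by move/eqP->.
Qed.

Lemma max_mono_BIP n (K : eqType) (omega : 'I_n -> K) (chi : 'I_n -> side) :
  is_max_mono_BI omega chi (max_mono_BI omega chi).
Proof. by rewrite max_mono_BI_unique. Qed.

(* [\prod_(i in V) x i] is the product in increasing order of i. *)
Definition phi_part (R : realType) (A : algType R[i]) (phi : {scalar A}) n
    (pi : {set {set 'I_n}}) (x : 'I_n -> A) : R[i] :=
  \prod_(V in pi) phi (\prod_(i in V) x i).

Definition nonunital_subalgebra (R : realType) (A : algType R[i])
    (S : set A) : Prop :=
  [/\ S 0,
      forall (c : R[i]) u v, S u -> S v -> S (c *: u + v) &
      forall u v, S u -> S v -> S (u * v)].

Definition alg_gen (R : realType) (A : algType R[i]) (a : A) : set A :=
  smallest (@nonunital_subalgebra R A) [set a]%classic.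

Definition bi_boolean_independent (R : realType) (A : algType R[i])
    (phi : {scalar A}) (K : eqType) (F : K -> side -> set A) : Prop :=
  (forall k s, nonunital_subalgebra (F k s)) /\
  forall n (chi : 'I_n -> side) (omega : 'I_n -> K) (x : 'I_n -> A),
    (0 < n)%N -> (forall j, F (omega j) (chi j) (x j)) ->
    phi (\prod_(j < n) x j) = phi_part phi (max_mono_BI omega chi) x.

Lemma alg_gen_subalgebra (R : realType) (A : algType R[i]) (a : A) :
  nonunital_subalgebra (alg_gen a).
Proof.
split=> [S [[]]//|c u v Su Sv S SP|u v Su Sv S SP].
- by case: (SP) => -[_ H _] _; apply: H; [apply: Su|apply: Sv].
- by case: (SP) => -[_ _ H] _; apply: H; [apply: Su|apply: Sv].
Qed.

Definition bi_boolean_independent_pairs (R : realType) (A : algType R[i])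
    (phi : {scalar A}) (a1 b1 a2 b2 : A) : Prop :=
  bi_boolean_independent phi (fun (k : 'I_2) (s : side) =>
    match s with
    | Left => alg_gen (if k == ord0 then a1 else a2)
    | Right => alg_gen (if k == ord0 then b1 else b2)
    end).

(* Main.v *)
From HB Require Import structures.
Require Import Defs.
From mathcomp Require Import all_boot all_order all_algebra.
From mathcomp Require Import reals complex.
From mathcomp Require Import boolp.
From mathcomp Require Import ring zify.

Import GRing.Theory.
Local Open Scope ring_scope.

Set Implicit Arguments.
Unset Strict Implicit.
Unset Printing Implicit Defensive.

(** A word in the [a]'s followed by a word in the [b]'s factors under [phi] at
    every change of colour met along the chi-order, so the covariance
    [phi (u v) - phi u phi v] of a left [u] and a right [v] only sees the last
    runs of letters of [u] and [v], and only when these have the same colour.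
    Sorting the words of [sum_m z^m ((1+a1)(1+a2))^m] and [sum_n w^n (b1+b2)^n]
    by their last letter then writes the covariance of the two series as a
    combination of those of [(1+a_k)^m] and [b_k^n], [k = 1, 2].  On the other
    hand, splitting off the block of the first position gives
    [cov(x^m, y^n) = H_x(z) H_y(w) reduced_eta(x, y)] and [H_x (1 - eta_x) = 1],
    where [H_x] is the moment series, and the identity follows by algebra in the
    ring of power series.  The second identity is the same one with the two
    sides and the two colours exchanged. *)

(** The asymmetry of the formula comes from the order of the two factors: within one factor
    (1+a1)(1+a2) the letter a2 may follow the a1 of the same factor, but not conversely. Let p be
    the moment series of the product and h_k that of 1+a_k. Prolonging the words not ending in a1 by
    final runs of a1 multiplies their series by (1-z) h_1 and yields p, so that series is p (1 -
    eta)/(1-z), with eta that of 1+a1. The prefixes of final runs of a1 and of a2 then have series z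
    p/((1-z) h_1) and p eta/((1-z) h_2). The factors (1-z) h_k are absorbed by the covariances of
    the runs, and the quotient eta/z is what remains in front of the second term. *)

Lemma enum_imset_increasing k n (f : 'I_k -> 'I_n) (V : {set 'I_k}) :
  (forall i j : 'I_k, (i < j)%N -> (f i < f j)%N) ->
  enum (f @: V) = map f (enum V).
Proof.
move=> finc; apply: (inj_map val_inj).
have srt m (W : {set 'I_m}) : sorted ltn (map val (enum W)).
  apply: (subseq_sorted ltn_trans _ (iota_ltn_sorted 0 m)).
  rewrite -val_enum_ord {1}/enum_mem -enumT; apply: map_subseq.
  exact: filter_subseq.
apply: (irr_sorted_eq ltn_trans ltnn (srt _ _)).
  rewrite -map_comp sorted_map.
  have := srt k V; rewrite sorted_map; apply: sub_sorted => i j; exact: finc.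
move=> p; apply/mapP/mapP => [[q + ->]|[q + ->]].
  rewrite mem_enum => /imsetP[i iV ->]; exists (f i) => //.
  by apply: map_f; rewrite mem_enum.
case/mapP=> i; rewrite mem_enum => iV ->; exists (f i) => //.
by rewrite mem_enum; apply: imset_f.
Qed.

Lemma prod_imset_increasing (A : nzRingType) k n (f : 'I_k -> 'I_n)
    (V : {set 'I_k}) (x : 'I_n -> A) :
  (forall i j : 'I_k, (i < j)%N -> (f i < f j)%N) ->
  \prod_(i in f @: V) x i = \prod_(i in V) x (f i).
Proof.
move=> finc.
have E m (W : {set 'I_m}) (y : 'I_m -> A) :
    \prod_(i in W) y i = \prod_(i <- enum W) y i.
  by rewrite -big_filter [X in _ = \prod_(i <- X) _]/enum_mem.
by rewrite !E (enum_imset_increasing _ finc) big_map.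
Qed.

(** The arities [#|f @: V|] and [#|V|] are equal but not convertible, so [B] is compared at a
    generic arity [m], identified with [#|V|] only afterwards. *)
Lemma restr_imset T T' U (B : forall n, ('I_n -> T) -> ('I_n -> T') -> U)
    k n (f : 'I_k -> 'I_n) (V : {set 'I_k}) (chi : 'I_n -> T) (x : 'I_n -> T') :
  (forall i j : 'I_k, (i < j)%N -> (f i < f j)%N) ->
  B #|f @: V| (restr chi (f @: V)) (restr x (f @: V)) =
  B #|V| (restr (chi \o f) V) (restr (x \o f) V).
Proof.
move=> finc; have H m (g : 'I_m -> 'I_n) (h : 'I_#|V| -> 'I_n) : m = #|V| ->
    (forall (i : 'I_m) (j : 'I_#|V|), i = j :> nat -> g i = h j) ->
    B m (chi \o g) (x \o g) = B #|V| (chi \o h) (x \o h).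
  move=> mV; subst m => gh.
  by congr (B _ _ _); apply/funext=> i /=; rewrite (gh _ i).
apply: (H _ (fun i => enum_val i) (fun i => f (enum_val i))).
  by rewrite !cardE (enum_imset_increasing _ finc) size_map.
move=> i j ij; rewrite (enum_val_nth (f (enum_val j))) ij.
rewrite (enum_imset_increasing _ finc) (nth_map (enum_val j)) -?cardE//.
by rewrite -enum_val_nth.
Qed.

Lemma increasing_inj k n (f : 'I_k -> 'I_n) :
  (forall i j : 'I_k, (i < j)%N -> (f i < f j)%N) -> injective f.
Proof.
move=> finc i j fij; apply: val_inj; case: (ltngtP (val i) (val j)) => //.
  by move=> /finc; rewrite fij ltnn.
by move=> /finc; rewrite fij ltnn.
Qed.

Lemma chi_lt_comp k n (f : 'I_k -> 'I_n) (chi : 'I_n -> side) i j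
    (finc : forall i j : 'I_k, (i < j)%N -> (f i < f j)%N) :
  chi_lt (chi \o f) i j = chi_lt chi (f i) (f j).
Proof.
have E a b : (f a < f b)%N = (a < b)%N.
  apply/idP/idP => [|/finc//]; case: (ltngtP a b) => [//|/finc ba ab|].
    by have := ltn_trans ab ba; rewrite ltnn.
  by move/val_inj->; rewrite ltnn.
by rewrite /chi_lt /= !E.
Qed.

Lemma chi_lt_irr n (chi : 'I_n -> side) i : chi_lt chi i i = false.
Proof. by rewrite chi_ltE ltnn. Qed.

Lemma chi_lt_trans n (chi : 'I_n -> side) i j l :
  chi_lt chi i j -> chi_lt chi j l -> chi_lt chi i l.
Proof. by rewrite !chi_ltE; apply: ltn_trans. Qed.

(** * Cutting the chi-order in two *)

Lemma partition_setTP n (pi : {set {set 'I_n}}) :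
  reflect [/\ forall V, V \in pi -> V != finset.set0,
              forall i, exists2 V, V \in pi & i \in V
            & forall i V W, V \in pi -> W \in pi -> i \in V -> i \in W -> V = W]
          (partition pi [set: 'I_n]).
Proof.
apply: (iffP idP) => [piP|[ne cov tr]].
  have [_ /trivIsetP tr n0] := and3P piP; split.
  - by move=> V Vpi; apply: contraNneq n0 => <-.
  - move=> i; have : i \in cover pi by rewrite (cover_partition piP) inE.
    by case/bigcupP=> V; exists V.
  - move=> i V W Vpi Wpi iV iW; apply: contraTeq isT => /(tr _ _ Vpi Wpi).
    by rewrite disjoints_subset => /subsetP/(_ _ iV); rewrite inE iW.
apply/and3P; split.
- rewrite eqEsubset finset.subsetT /=; apply/subsetP=> i _.
  by have [V Vpi iV] := cov i; apply/bigcupP; exists V.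
- apply/trivIsetP=> V W Vpi Wpi; apply: contraR => /pred0Pn[i /= /andP[iV iW]].
  exact/eqP/(tr i).
- by apply/negP=> /ne; rewrite eqxx.
Qed.

(** [f] enumerates an initial segment of the chi-order and [g] its complement. Both increase for the
    usual order, so that restrictions and non-commutative products transport without reordering,
    although the segment need not consist of consecutive positions. *)
Record chi_cut N k l (chi : 'I_N -> side) (f : 'I_k -> 'I_N)
    (g : 'I_l -> 'I_N) : Prop := ChiCut {
  cut_l : forall i j : 'I_k, (i < j)%N -> (f i < f j)%N;
  cut_r : forall i j : 'I_l, (i < j)%N -> (g i < g j)%N;
  cut_lt : forall i j, chi_lt chi (f i) (g j);
  cut_cover : forall p, (exists i, p = f i) \/ (exists j, p = g j)
}.

Definition cut_join N k l (f : 'I_k -> 'I_N) (g : 'I_l -> 'I_N)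
    (pi1 : {set {set 'I_k}}) (pi2 : {set {set 'I_l}}) : {set {set 'I_N}} :=
  [set f @: (V : {set 'I_k}) | V in pi1] :|: [set g @: (V : {set 'I_l}) | V in pi2].

Lemma cut_neq N k l chi (f : 'I_k -> 'I_N) (g : 'I_l -> 'I_N) i j :
  chi_cut chi f g -> f i <> g j.
Proof. by move=> fg E; have := cut_lt fg i j; rewrite E chi_lt_irr. Qed.

Lemma cut_notl N k l chi (f : 'I_k -> 'I_N) (g : 'I_l -> 'I_N)
    (V : {set 'I_k}) j :
  chi_cut chi f g -> (g j \in f @: V) = false.
Proof. by move=> fg; apply/imsetP => -[i _ /esym/(cut_neq fg)]. Qed.

Lemma cut_notr N k l chi (f : 'I_k -> 'I_N) (g : 'I_l -> 'I_N)
    (V : {set 'I_l}) i :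
  chi_cut chi f g -> (f i \in g @: V) = false.
Proof. by move=> fg; apply/imsetP => -[j _ /(cut_neq fg)]. Qed.

Lemma cut_join_partition N k l chi (f : 'I_k -> 'I_N) (g : 'I_l -> 'I_N) pi1 pi2 :
  chi_cut chi f g -> partition pi1 [set: 'I_k] -> partition pi2 [set: 'I_l] ->
  partition (cut_join f g pi1 pi2) [set: 'I_N].
Proof.
move=> fg /partition_setTP[ne1 cov1 tr1] /partition_setTP[ne2 cov2 tr2].
have fI := increasing_inj (cut_l fg); have gI := increasing_inj (cut_r fg).
apply/partition_setTP; split.
- by move=> V /setUP[|] /imsetP[W Wpi ->]; rewrite imset_eq0; [apply: ne1|apply: ne2].
- move=> p; have [[i ->]|[j ->]] := cut_cover fg p.
    have [V Vpi iV] := cov1 i; exists (f @: V); last exact: imset_f.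
    by apply/setUP; left; apply: imset_f.
  have [V Vpi iV] := cov2 j; exists (g @: V); last exact: imset_f.
  by apply/setUP; right; apply: imset_f.
- move=> p V W; rewrite !inE.
  case/orP=> /imsetP[V' V'pi ->] /orP[] /imsetP[W' W'pi ->] /imsetP[i iV ->].
  + by rewrite mem_imset// => iW; rewrite (tr1 i V' W').
  + by rewrite (cut_notr _ _ fg).
  + by rewrite (cut_notl _ _ fg).
  + by rewrite mem_imset// => iW; rewrite (tr2 i V' W').
Qed.

Lemma cut_interval_l N k l chi (f : 'I_k -> 'I_N) (g : 'I_l -> 'I_N)
    (V : {set 'I_k}) :
  chi_cut chi f g -> chi_interval chi (f @: V) = chi_interval (chi \o f) V.
Proof.
move=> fg; have fI := increasing_inj (cut_l fg).
apply/forall_inP/forall_inP=> H i.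
  move=> iV; apply/forall_inP=> p pV; apply/forallP=> j.
  have /forall_inP/(_ (f p) (imset_f _ pV))/forallP/(_ (f j)) := H _ (imset_f f iV).
  by rewrite mem_imset// !(chi_lt_comp chi _ _ (cut_l fg)).
case/imsetP=> i' iV ->; apply/forall_inP=> _ /imsetP[p pV ->].
apply/forallP=> q; apply/implyP => /andP[iq qp].
have [[j qE]|[j qE]] := cut_cover fg q; rewrite qE in iq qp *.
  have /forall_inP/(_ p pV)/forallP/(_ j)/implyP := H _ iV.
  rewrite mem_imset// !(chi_lt_comp chi _ _ (cut_l fg)).
  by apply; rewrite iq qp.
by have := chi_lt_trans (cut_lt fg p j) qp; rewrite chi_lt_irr.
Qed.

Lemma cut_interval_r N k l chi (f : 'I_k -> 'I_N) (g : 'I_l -> 'I_N)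
    (V : {set 'I_l}) :
  chi_cut chi f g -> chi_interval chi (g @: V) = chi_interval (chi \o g) V.
Proof.
move=> fg; have fI := increasing_inj (cut_r fg).
apply/forall_inP/forall_inP=> H i.
  move=> iV; apply/forall_inP=> p pV; apply/forallP=> j.
  have /forall_inP/(_ (g p) (imset_f _ pV))/forallP/(_ (g j)) := H _ (imset_f g iV).
  by rewrite mem_imset// !(chi_lt_comp chi _ _ (cut_r fg)).
case/imsetP=> i' iV ->; apply/forall_inP=> _ /imsetP[p pV ->].
apply/forallP=> q; apply/implyP => /andP[iq qp].
have [[j qE]|[j qE]] := cut_cover fg q; rewrite qE in iq qp *.
  by have := chi_lt_trans (cut_lt fg j i') iq; rewrite chi_lt_irr.
have /forall_inP/(_ p pV)/forallP/(_ j)/implyP := H _ iV.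
rewrite mem_imset// !(chi_lt_comp chi _ _ (cut_r fg)).
by apply; rewrite iq qp.
Qed.

Lemma cut_join_BI N k l chi (f : 'I_k -> 'I_N) (g : 'I_l -> 'I_N) pi1 pi2 :
  chi_cut chi f g -> pi1 \in BI (chi \o f) -> pi2 \in BI (chi \o g) ->
  cut_join f g pi1 pi2 \in BI chi.
Proof.
move=> fg; rewrite !inE => /andP[P1 /forall_inP I1] /andP[P2 /forall_inP I2].
rewrite (cut_join_partition fg)//=; apply/forall_inP=> V /setUP[] /imsetP[W Wpi ->].
  by rewrite (cut_interval_l _ fg) I1.
by rewrite (cut_interval_r _ fg) I2.
Qed.

Lemma big_cut_join (C : comNzRingType) N k l chi (f : 'I_k -> 'I_N)
    (g : 'I_l -> 'I_N) pi1 pi2 (F : {set 'I_N} -> C) :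
  chi_cut chi f g -> partition pi1 [set: 'I_k] ->
  \prod_(V in cut_join f g pi1 pi2) F V =
  (\prod_(V in pi1) F (f @: V)) * \prod_(V in pi2) F (g @: V).
Proof.
move=> fg /partition_setTP[ne1 _ _].
have fI := increasing_inj (cut_l fg); have gI := increasing_inj (cut_r fg).
pose im n (h : 'I_n -> 'I_N) (V : {set 'I_n}) := h @: V.
have im_f : {in pi1 &, injective (im _ f)} by move=> V W _ _; apply: imset_inj.
have im_g : {in pi2 &, injective (im _ g)} by move=> V W _ _; apply: imset_inj.
rewrite -(big_imset F im_f) -(big_imset F im_g) -bigU.
  by apply: eq_bigl => V; rewrite !inE.
apply/pred0P => V /=; apply/negP=> /andP[/imsetP[W Wpi ->] /imsetP[W' _]].
have /set0Pn[i iW] := ne1 _ Wpi.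
by move/setP/(_ (f i)); rewrite (cut_notr _ _ fg) imset_f.
Qed.

Lemma imset_preimset_sub N l (g : 'I_l -> 'I_N) (W : {set 'I_N}) :
  (forall p, p \in W -> exists j, p = g j) -> g @: (g @^-1: W) = W.
Proof.
move=> Wg; apply/setP=> p; apply/imsetP/idP => [[j + ->]|pW]; first by rewrite inE.
by have [j pE] := Wg p pW; exists j; rewrite // inE -pE.
Qed.

Lemma preimset_imset N l (g : 'I_l -> 'I_N) (V : {set 'I_l}) : injective g ->
  g @^-1: (g @: V) = V.
Proof. by move=> gI; apply/setP=> j; rewrite inE mem_imset. Qed.

Definition cut_rest N k l (f : 'I_k -> 'I_N) (g : 'I_l -> 'I_N)
    (pi : {set {set 'I_N}}) : {set {set 'I_l}} :=
  [set g @^-1: (W : {set 'I_N}) | W in pi :\ f @: [set: 'I_k]].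

Lemma cut_rest_block N k l chi (f : 'I_k -> 'I_N) (g : 'I_l -> 'I_N) pi
    (W : {set 'I_N}) : chi_cut chi f g ->
  pi \in BI chi -> f @: [set: 'I_k] \in pi -> W \in pi :\ f @: [set: 'I_k] ->
  g @: (g @^-1: W) = W.
Proof.
move=> fg; rewrite inE => /andP[/partition_setTP[_ _ tr] _] Fpi /setD1P[WF Wpi].
apply: imset_preimset_sub => p pW.
have [[i pE]|//] := cut_cover fg p; case/eqP: WF.
by apply: (tr p) => //; rewrite pE imset_f.
Qed.

Lemma cut_rest_BI N k l chi (f : 'I_k -> 'I_N) (g : 'I_l -> 'I_N) pi :
  chi_cut chi f g -> pi \in BI chi -> f @: [set: 'I_k] \in pi ->
  cut_rest f g pi \in BI (chi \o g).
Proof.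
move=> fg piB Fpi; have gE W := cut_rest_block fg piB Fpi (W := W).
move: piB; rewrite !inE => /andP[/partition_setTP[ne cov tr] /forall_inP I].
apply/andP; split; last first.
  apply/forall_inP=> _ /imsetP[W WpiF ->]; rewrite -(cut_interval_r _ fg) gE//.
  by apply: I; case/setD1P: WpiF.
apply/partition_setTP; split.
- move=> _ /imsetP[W WpiF ->]; rewrite -(imset_eq0 g) gE//.
  by apply: ne; case/setD1P: WpiF.
- move=> j; have [W Wpi jW] := cov (g j).
  exists (g @^-1: W); last by rewrite inE.
  apply: imset_f; rewrite !inE Wpi andbT; apply: contraTneq jW => ->.
  by rewrite (cut_notl _ _ fg).
- move=> j _ _ /imsetP[V /setD1P[_ Vpi] ->] /imsetP[W /setD1P[_ Wpi] ->].
  by rewrite !inE => jV jW; rewrite (tr (g j) V W).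
Qed.

Lemma cut_join_rest N k l chi (f : 'I_k -> 'I_N) (g : 'I_l -> 'I_N) pi :
  chi_cut chi f g -> pi \in BI chi -> f @: [set: 'I_k] \in pi ->
  cut_join f g [set [set: 'I_k]] (cut_rest f g pi) = pi.
Proof.
move=> fg piB Fpi; have gE W := cut_rest_block fg piB Fpi (W := W).
rewrite /cut_join imset_set1; apply/setP=> W; rewrite !inE.
have [->|WF] /= := eqVneq W; first by rewrite Fpi.
apply/imsetP/idP => [[_ /imsetP[V VpiF ->] ->]|Wpi].
  by rewrite gE//; case/setD1P: VpiF.
exists (g @^-1: W); last by rewrite gE// !inE WF.
by apply: imset_f; rewrite !inE WF.
Qed.

Lemma cut_rest_join N k l chi (f : 'I_k -> 'I_N) (g : 'I_l -> 'I_N) pi :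
  (0 < k)%N -> chi_cut chi f g ->
  cut_rest f g (cut_join f g [set [set: 'I_k]] pi) = pi.
Proof.
move=> k0 fg; have gI := increasing_inj (cut_r fg).
have FgV (V : {set 'I_l}) : (g @: V == f @: [set: 'I_k]) = false.
  apply/eqP=> /setP/(_ (f (Ordinal k0))).
  by rewrite (cut_notr _ _ fg) imset_f.
rewrite /cut_rest /cut_join imset_set1; apply/setP=> V; apply/imsetP/idP.
  case=> W /setD1P[WF] /setU1P[E|]; first by rewrite E eqxx in WF.
  by case/imsetP=> V' V'pi -> ->; rewrite preimset_imset.
move=> Vpi; exists (g @: V); last by rewrite preimset_imset.
by rewrite !inE FgV /= imset_f.
Qed.

(** Deleting the block formed by the initial segment is a bijection onto the bi-interval partitions
    of the complement; [cut_join] puts the block back. *)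
Lemma sum_BI_block (C : comNzRingType) N k l chi (f : 'I_k -> 'I_N)
    (g : 'I_l -> 'I_N) (F : {set 'I_N} -> C) :
  (0 < k)%N -> chi_cut chi f g ->
  \sum_(pi in BI chi | f @: [set: 'I_k] \in pi) \prod_(V in pi) F V =
  F (f @: [set: 'I_k]) *
    \sum_(pi in BI (chi \o g)) \prod_(V in pi) F (g @: V).
Proof.
move=> k0 fg; rewrite (reindex_onto (cut_join f g [set [set: 'I_k]]) (cut_rest f g)).
  have B0 := BI_setT (chi \o f) k0.
  rewrite mulr_sumr; apply: eq_big => [pi|pi _]; last first.
    rewrite (big_cut_join _ _ fg) ?big_set1//.
    by move: B0; rewrite inE => /andP[].
  apply/andP/idP => [[/andP[jB Fj] /eqP <-]|piB].
    exact: cut_rest_BI.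
  rewrite (cut_join_BI fg) ?(cut_rest_join _ k0 fg)//=; split=> //.
  by apply/setUP; left; rewrite imset_set1 inE.
by move=> pi /andP[piB Fpi]; apply: (cut_join_rest fg).
Qed.

(** Serves when the first block fills all positions: the moment-cumulant formula is given in
    positive length only, and the value 1 matches [phi 1 = 1]. *)
Lemma sum_BI0 (C : comNzRingType) (chi : 'I_0 -> side) (F : {set 'I_0} -> C) :
  \sum_(pi in BI chi) \prod_(V in pi) F V = 1.
Proof.
have E pi : (pi \in BI chi) = (pi == finset.set0).
  rewrite inE; apply/andP/eqP => [[/partition_setTP[ne _ _] _]|->].
    apply/setP=> V; rewrite inE; apply/negP=> /ne/set0Pn[] [].
    by [].
  split; last by apply/forall_inP=> V; rewrite inE.
  by apply/partition_setTP; split=> [V|[]//|i V W]; rewrite inE.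
by under eq_bigl do rewrite E; rewrite big_pred1_eq big_set0.
Qed.

Lemma sum_BI_moment (R : realType) (A : algType R[i]) (phi : {scalar A}) N k l
    (chi : 'I_N -> side) (f : 'I_k -> 'I_N) (g : 'I_l -> 'I_N) (x : 'I_N -> A) :
  phi 1 = 1 -> (0 < k)%N -> chi_cut chi f g ->
  \sum_(pi in BI chi | f @: [set: 'I_k] \in pi)
     \prod_(V in pi) bcumulant phi #|V| (restr chi V) (restr x V) =
  bcumulant phi k (chi \o f) (x \o f) * phi (\prod_(j < l) x (g j)).
Proof.
move=> phi1 k0 fg; rewrite (sum_BI_block _ k0 fg).
rewrite (restr_imset (bcumulant phi) _ _ _ (cut_l fg)) restr_setT; congr (_ * _).
case: l g fg => [|l] g fg; first by rewrite sum_BI0 big_ord0 phi1.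
have [_ mc] := bcumulantP phi; rewrite (mc _ (chi \o g))//.
apply: eq_bigr => pi _; apply: eq_bigr => V _.
by rewrite (restr_imset (bcumulant phi) _ _ _ (cut_r fg)).
Qed.

(** * Splitting off the first block of a bi-interval partition *)

(* [std_side M] has the left positions first; it makes the [k] first positions
   for the chi-order the [k] first ones if [k <= M], and otherwise all the left
   ones together with the last [k - M] right ones. *)
Definition std_side M N : 'I_N -> side := fun i => if (i < M)%N then Left else Right.

(** The shift by [N - k] skips the right positions that stay in the complement; it occurs only when
    [k > M]. *)
Fact cutl_proof M N k (kN : (k <= N)%N) (p : 'I_k) :
  ((if (p < M)%N then p : nat else p + (N - k)) < N)%N.
Proof. by have := ltn_ord p; case: ifP; lia. Qed.

Definition cutl M N k (kN : (k <= N)%N) (p : 'I_k) : 'I_N :=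
  Ordinal (cutl_proof M kN p).

Fact cutr_proof M N k (kN : (k <= N)%N) (p : 'I_(N - k)) : (minn M k + p < N)%N.
Proof. by have := ltn_ord p; lia. Qed.

Definition cutr M N k (kN : (k <= N)%N) (p : 'I_(N - k)) : 'I_N :=
  Ordinal (cutr_proof M kN p).

Lemma std_cut M N k (kN : (k <= N)%N) :
  chi_cut (@std_side M N) (cutl M kN) (cutr M kN).
Proof.
split.
- by move=> i j ij /=; do 2!case: ifP; lia.
- by move=> i j ij /=; lia.
- move=> i j; have := ltn_ord i; have := ltn_ord j.
  rewrite /chi_lt /std_side /= => jd ik.
  case: (ltnP i M) => iM; rewrite ?iM.
    by case: ifP => //; lia.
  have -> : (i + (N - k) < M)%N = false by lia.
  by case: ifP; lia.
- move=> p; have pN := ltn_ord p.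
  have [pk|kp] := ltnP p (minn M k).
    have pk' : (p < k)%N by lia.
    by left; exists (Ordinal pk'); apply: val_inj => /=; case: ifP; lia.
  have [pd|dp] := ltnP p (minn M k + (N - k)).
    have pd' : (p - minn M k < N - k)%N by lia.
    by right; exists (Ordinal pd'); apply: val_inj => /=; lia.
  have pk' : (p - (N - k) < k)%N by lia.
  by left; exists (Ordinal pk'); apply: val_inj => /=; case: ifP; lia.
Qed.

Definition chi_initial N (chi : 'I_N -> side) (V : {set 'I_N}) :=
  forall i j, i \in V -> chi_lt chi j i -> j \in V.

Lemma chi_lt_total N (chi : 'I_N -> side) i j :
  [\/ i = j, chi_lt chi i j | chi_lt chi j i].
Proof.
have [->|ij] := eqVneq i j; first exact: Or31.
have : (i < j)%N || (j < i)%N by rewrite -neq_ltn.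
rewrite /chi_lt; case: (chi i) (chi j) => [] [] /orP[] ?;
  by [apply: Or32|apply: Or33].
Qed.

Lemma chi_initial_eq N (chi : 'I_N -> side) (V W : {set 'I_N}) :
  chi_initial chi V -> chi_initial chi W -> #|V| = #|W| -> V = W.
Proof.
move=> Vi Wi VW; have [/eqP//|VWn] := boolP (V == W); exfalso.
have /subsetPn[p pV pW] : ~~ (V \subset W).
  by apply: contra VWn => VsW; rewrite eqEcard VsW VW leqnn.
suff WsV : W \subset V.
  by move: VWn; rewrite eq_sym eqEcard WsV VW leqnn.
apply/subsetP=> q qW; case: (chi_lt_total chi p q) => [<-//|pq|qp].
  by rewrite (Wi _ _ qW pq) in pW.
exact: Vi pV qp.
Qed.

Lemma cut_initial N k l chi (f : 'I_k -> 'I_N) (g : 'I_l -> 'I_N) :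
  chi_cut chi f g -> chi_initial chi (f @: [set: 'I_k]).
Proof.
move=> fg p q /imsetP[i _ ->] qi.
have [[j ->]|[j qE]] := cut_cover fg q; first exact: imset_f.
by have := chi_lt_trans (cut_lt fg i j); rewrite -qE => /(_ _ qi); rewrite chi_lt_irr.
Qed.

Lemma interval_initial N (chi : 'I_N -> side) (V : {set 'I_N}) o :
  (forall j, j != o -> chi_lt chi o j) -> o \in V -> chi_interval chi V ->
  chi_initial chi V.
Proof.
move=> omin oV /forall_inP/(_ _ oV)/forall_inP I i j iV ji.
have [->//|/omin oj] := eqVneq j o.
by move: (I i iV) => /forallP/(_ j)/implyP; apply; rewrite oj ji.
Qed.

(** A chi-interval containing the chi-minimum is an initial segment, hence determined by its
    cardinality. Here [ord0] is the chi-minimum because it is a left position, so the size of its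
    block sorts the partitions. *)
Lemma sum_BI_first_block (C : comNzRingType) M N
    (F : {set {set 'I_N.+1}} -> C) :
  \sum_(pi in BI (@std_side M.+1 N.+1)) F pi =
  \sum_(k < N.+1)
    \sum_(pi in BI (@std_side M.+1 N.+1) |
          cutl M.+1 (ltn_ord k) @: [set: 'I_k.+1] \in pi) F pi.
Proof.
set chi := @std_side M.+1 N.+1.
have fg k := std_cut M.+1 (ltn_ord (k : 'I_N.+1)).
have omin (j : 'I_N.+1) : j != ord0 -> chi_lt chi ord0 j.
  by rewrite -val_eqE /= => j0; rewrite /chi_lt /chi /std_side /=; case: ifP; lia.
have oF (k : 'I_N.+1) : ord0 \in cutl M.+1 (ltn_ord k) @: [set: 'I_k.+1].
  by apply/imsetP; exists ord0; rewrite ?inE//; apply: val_inj.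
have cF (k : 'I_N.+1) : #|cutl M.+1 (ltn_ord k) @: [set: 'I_k.+1]| = k.+1.
  rewrite card_imset ?cardsT ?card_ord//; exact: increasing_inj (cut_l (fg k)).
(* Block sizes run from 1 to [N.+1], so the predecessor of the size is a valid index and [inord]
   never takes its default value. *)
rewrite (partition_big (fun pi => inord (#|pblock pi ord0|).-1 : 'I_N.+1) xpredT)//=.
apply: eq_bigr => k _; apply: eq_bigl => pi; apply: andb_id2l.
rewrite inE => /andP[piP /forall_inP I].
have [_ tr _] := and3P piP.
have o_pi : ord0 \in cover pi by rewrite (cover_partition piP) inE.
apply/eqP/idP => [kE|Fpi]; last first.
  by rewrite (def_pblock tr Fpi (oF k)) cF; apply: val_inj; rewrite /= inordK.
suff -> : cutl M.+1 (ltn_ord k) @: [set: 'I_k.+1] = pblock pi ord0.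
  exact: pblock_mem.
apply: (chi_initial_eq (cut_initial (fg k))).
  apply: (interval_initial omin); first by rewrite mem_pblock.
  exact/I/pblock_mem.
have c0 : (0 < #|pblock pi ord0|)%N.
  by apply/card_gt0P; exists ord0; rewrite mem_pblock.
have cN : (#|pblock pi ord0| <= N.+1)%N.
  by rewrite -[X in (_ <= X)%N](card_ord N.+1) max_card.
by rewrite cF -kE inordK prednK.
Qed.

Lemma prod_two_values (A : nzRingType) (x y : A) c L : (c <= L)%N ->
  \prod_(j < L) (if (j < c)%N then x else y) = x ^+ c * y ^+ (L - c).
Proof.
move=> /subnKC; move: (L - c)%N => d <-; rewrite big_split_ord /=; congr (_ * _).
  rewrite -[in RHS](card_ord c) -prodr_const; apply: eq_bigr => j _.
  by rewrite ltn_ord.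
rewrite -[in RHS](card_ord d) -prodr_const; apply: eq_bigr => j _.
by rewrite ltnNge leq_addr.
Qed.

(** The first block consists either of [i.+1] letters [x], or of all the [x] together with the last
    [j.+1] letters [y], because the chi-order reads right positions backwards. Summing over the
    partitions of the other positions rebuilds a moment. *)
Lemma moment_first_block (R : realType) (A : algType R[i]) (phi : {scalar A})
    (x y : A) m n : phi 1 = 1 ->
  phi (x ^+ m.+1 * y ^+ n) =
  \sum_(i < m.+1) bcumulant_m phi i.+1 x * phi (x ^+ (m - i) * y ^+ n) +
  \sum_(j < n) bcumulant_mn phi m.+1 j.+1 x y * phi (y ^+ (n - j.+1)).
Proof.
move=> phi1; pose X N (i : 'I_N) := if (i < m.+1)%N then x else y.
have [_ mc] := bcumulantP phi.
have prodX : \prod_(i < (m + n).+1) X _ i = x ^+ m.+1 * y ^+ n.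
  by rewrite prod_two_values 1?subSS 1?addKn// ltnS leq_addr.
rewrite -prodX (mc _ (@std_side m.+1 _))// sum_BI_first_block.
under eq_bigr => k _ do
  rewrite (sum_BI_moment _ phi1 (ltn0Sn k) (std_cut m.+1 (ltn_ord k))).
rewrite (@big_split_ord _ _ _ m.+1 n); congr (_ + _); apply: eq_bigr => i _.
  congr (_ * phi _).
    have pm (p : 'I_i.+1) : (p < m.+1)%N by rewrite (leq_trans (ltn_ord p)).
    by congr (bcumulant phi _ _ _); apply/funext=> p /=;
      rewrite /std_side /X /= !pm.
  have im : (i < m.+1)%N := ltn_ord i.
  rewrite (eq_bigr (fun j : 'I__ => if (j < m - i)%N then x else y)) => [|j _].
    by rewrite prod_two_values /=; [congr (_ * _ ^+ _); lia|lia].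
  rewrite /X /= (minn_idPr _)//.
  by rewrite (_ : (i.+1 + j < m.+1)%N = (j < m - i)%N)//; lia.
rename i into j; have jn := ltn_ord j.
congr (_ * phi _).
  have H K (c : 'I_K -> 'I_(m + n).+1) : K = (m.+1 + j.+1)%N ->
      (forall p : 'I_K, (c p < m.+1)%N = (p < m.+1)%N) ->
      bcumulant phi K (@std_side m.+1 _ \o c) (@X _ \o c) =
      bcumulant_mn phi m.+1 j.+1 x y.
    by move=> KE; subst K => cE; congr (bcumulant phi _ _ _); apply/funext=> p;
      rewrite /std_side /X /= cE.
  apply: H => [|p] /=; first by rewrite addnS.
  have := ltn_ord p.
  by case: ifP => //= pm _; apply/negbTE; rewrite -leqNgt; lia.
rewrite /X (eq_bigr (fun=> y)) => [|p _] /=.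
  by rewrite prodr_const card_ord; congr (_ ^+ _); lia.
by case: ifP => //; lia.
Qed.

(** * Factorization of moments at a change of colour *)

Lemma max_mono_BI_in n (K : eqType) (omega : 'I_n -> K) (chi : 'I_n -> side) :
  max_mono_BI omega chi \in mono_BI omega chi.
Proof. by case/andP: (max_mono_BIP omega chi). Qed.

Lemma mono_BI_partition n (K : eqType) (omega : 'I_n -> K) (chi : 'I_n -> side) pi :
  pi \in mono_BI omega chi -> partition pi [set: 'I_n].
Proof. by rewrite inE [_ \in BI _]inE => /andP[/andP[]]. Qed.

(** Maximality only excludes strictly coarser partitions; the existence of a greatest one turns it
    into a comparison with all of them. *)
Lemma mono_BI_refines_max n (K : eqType) (omega : 'I_n -> K)
    (chi : 'I_n -> side) sigma :
  sigma \in mono_BI omega chi -> refines sigma (max_mono_BI omega chi).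
Proof.
have [rho rhoB rhoG] := max_mono_BI_greatest omega chi.
have /andP[maxB /forall_inP/(_ _ rhoB)/implyP/(_ (rhoG _ maxB))/eqP <-] :=
  max_mono_BIP omega chi.
exact: rhoG.
Qed.

Lemma max_mono_BI_eq n (K : eqType) (omega : 'I_n -> K) (chi : 'I_n -> side) pi :
  pi \in mono_BI omega chi ->
  (forall sigma, sigma \in mono_BI omega chi -> refines sigma pi) ->
  pi = max_mono_BI omega chi.
Proof.
move=> piB piG; have maxB := max_mono_BI_in omega chi.
by apply: refines_anti; rewrite ?(mono_BI_partition piB) ?(mono_BI_partition maxB)
  ?mono_BI_refines_max ?piG.
Qed.

(** Completing [V] by singletons gives a monochromatic bi-interval partition, which must refine the
    maximal one. *)
Lemma mono_interval_sub_max n (K : eqType) (omega : 'I_n -> K)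
    (chi : 'I_n -> side) V :
  V != finset.set0 -> chi_interval chi V -> constant_on omega V ->
  exists2 W, W \in max_mono_BI omega chi & V \subset W.
Proof.
move=> V0 VI VC.
pose sigma := V |: [set [set j] | j in ~: V].
have /forall_inP/(_ V) : refines sigma (max_mono_BI omega chi).
  apply: mono_BI_refines_max; rewrite !inE -andbA; apply/and3P; split.
  - apply/partition_setTP; split.
    + move=> W /setU1P[->//|/imsetP[j _ ->]].
      by apply/set0Pn; exists j; rewrite inE.
    + move=> i; have [iV|iV] := boolP (i \in V).
        by exists V => //; rewrite !inE eqxx.
      exists [set i]; rewrite ?inE//; apply/orP; right.
      by apply/imsetP; exists i; rewrite ?inE.
    + move=> i W W' /setU1P[->|/imsetP[j + ->]] /setU1P[->|/imsetP[j' + ->]] //.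
      * by rewrite !inE => jV iV /eqP ij; rewrite -ij iV in jV.
      * by rewrite !inE => jV /eqP -> jV'; rewrite jV' in jV.
      * by move=> _ _; rewrite !inE => /eqP <- /eqP <-.
  - apply/forall_inP=> W /setU1P[->//|/imsetP[j _ ->]].
    apply/forall_inP=> i /set1P ->; apply/forall_inP=> k /set1P ->.
    apply/forallP=> l; apply/implyP=> /andP[jl lj].
    by have := chi_lt_trans jl lj; rewrite chi_lt_irr.
  - apply/forall_inP=> W /setU1P[->//|/imsetP[j _ ->]].
    by apply/forall_inP=> i /set1P ->; apply/forall_inP=> k /set1P ->.
case/(_ (setU11 _ _))/existsP=> W /andP[Wmax VW]; by exists W.
Qed.

(** [f i0] and [g j0] are neighbours for the chi-order and have different colours. A monochromatic
    chi-interval meeting both sides of the cut would contain both of them, so every block lies on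
    one side. *)
Lemma cut_join_max N k l chi (f : 'I_k -> 'I_N) (g : 'I_l -> 'I_N)
    (K : eqType) (omega : 'I_N -> K) i0 j0 :
  chi_cut chi f g -> (forall i, i != i0 -> chi_lt chi (f i) (f i0)) ->
  (forall j, j != j0 -> chi_lt chi (g j0) (g j)) ->
  omega (f i0) != omega (g j0) ->
  cut_join f g (max_mono_BI (omega \o f) (chi \o f))
    (max_mono_BI (omega \o g) (chi \o g)) = max_mono_BI omega chi.
Proof.
move=> fg i0max j0min fgn.
have := max_mono_BI_in (omega \o g) (chi \o g); rewrite inE => /andP[B2 /forall_inP C2].
have := max_mono_BI_in (omega \o f) (chi \o f); rewrite inE => /andP[B1 /forall_inP C1].
apply: max_mono_BI_eq.
  rewrite inE (cut_join_BI fg)//=; apply/forall_inP=> V /setUP[] /imsetP[W Wpi ->].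
    apply/forall_inP=> _ /imsetP[i iW ->]; apply/forall_inP=> _ /imsetP[j jW ->].
    by move: (C1 _ Wpi) => /forall_inP/(_ _ iW)/forall_inP/(_ _ jW).
  apply/forall_inP=> _ /imsetP[i iW ->]; apply/forall_inP=> _ /imsetP[j jW ->].
  by move: (C2 _ Wpi) => /forall_inP/(_ _ iW)/forall_inP/(_ _ jW).
move=> sigma sB; have /partition_setTP[ne _ _] := mono_BI_partition sB.
move: sB; rewrite !inE => /andP[/andP[_ /forall_inP I] /forall_inP C].
apply/forall_inP=> V Vs; have V0 := ne _ Vs.
have VI i l' j : i \in V -> j \in V -> chi_lt chi i l' -> chi_lt chi l' j -> l' \in V.
  move=> iV jV il lj.
  by move: (I _ Vs) => /forall_inP/(_ _ iV)/forall_inP/(_ _ jV)/forallP/(_ l')/implyP; apply; rewrite il.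
have VC i j : i \in V -> j \in V -> omega i = omega j.
  by move=> iV jV; apply/eqP; move: (C _ Vs) => /forall_inP/(_ _ iV)/forall_inP/(_ _ jV).
have Vfg i j : f i \in V -> g j \in V -> False.
  move=> iV jV; case/eqP: fgn; apply: VC.
    have [<-//|/i0max ii0] := eqVneq i i0.
    exact: VI iV jV ii0 (cut_lt fg _ _).
  have [<-//|/j0min jj0] := eqVneq j j0.
  exact: VI iV jV (cut_lt fg _ _) jj0.
have /set0Pn[p pV] := V0; have [[i pE]|[j pE]] := cut_cover fg p.
  have VE : f @: (f @^-1: V) = V.
    apply: imset_preimset_sub => q qV; have [//|[j qE]] := cut_cover fg q.
    by rewrite pE qE in pV qV; case: (Vfg _ _ pV qV).
  have [|||W Wpi VW] := @mono_interval_sub_max _ _ (omega \o f) (chi \o f) (f @^-1: V).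
  - by rewrite -(imset_eq0 f) VE.
  - by rewrite -(cut_interval_l _ fg) VE I.
  - apply/forall_inP=> a aV; apply/forall_inP=> b bV; rewrite !inE in aV bV.
    by apply/eqP/VC.
  - apply/existsP; exists (f @: W); rewrite -VE imsetS// andbT.
    by apply/setUP; left; apply: imset_f.
have VE : g @: (g @^-1: V) = V.
  apply: imset_preimset_sub => q qV; have [[i qE]|//] := cut_cover fg q.
  by rewrite pE qE in pV qV; case: (Vfg _ _ qV pV).
have [|||W Wpi VW] := @mono_interval_sub_max _ _ (omega \o g) (chi \o g) (g @^-1: V).
- by rewrite -(imset_eq0 g) VE.
- by rewrite -(cut_interval_r _ fg) VE I.
- apply/forall_inP=> a aV; apply/forall_inP=> b bV; rewrite !inE in aV bV.
  by apply/eqP/VC.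
- apply/existsP; exists (g @: W); rewrite -VE imsetS// andbT.
  by apply/setUP; right; apply: imset_f.
Qed.

Lemma phi_part_cut (R : realType) (A : algType R[i]) (phi : {scalar A})
    N k l chi (f : 'I_k -> 'I_N) (g : 'I_l -> 'I_N) pi1 pi2 (x : 'I_N -> A) :
  chi_cut chi f g -> partition pi1 [set: 'I_k] ->
  phi_part phi (cut_join f g pi1 pi2) x =
  phi_part phi pi1 (x \o f) * phi_part phi pi2 (x \o g).
Proof.
move=> fg piP; rewrite /phi_part (big_cut_join _ _ fg)//; congr (_ * _).
  by apply: eq_bigr => V _; rewrite (prod_imset_increasing _ _ (cut_l fg)).
by apply: eq_bigr => V _; rewrite (prod_imset_increasing _ _ (cut_r fg)).
Qed.

Lemma bi_boolean_cut (R : realType) (A : algType R[i]) (phi : {scalar A})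
    (K : eqType) (F : K -> side -> classical_sets.set A) N k l chi
    (f : 'I_k -> 'I_N) (g : 'I_l -> 'I_N) (omega : 'I_N -> K) (x : 'I_N -> A) i0 j0 :
  bi_boolean_independent phi F -> (forall j, F (omega j) (chi j) (x j)) ->
  chi_cut chi f g -> (forall i, i != i0 -> chi_lt chi (f i) (f i0)) ->
  (forall j, j != j0 -> chi_lt chi (g j0) (g j)) ->
  omega (f i0) != omega (g j0) ->
  phi (\prod_(i < N) x i) =
  phi (\prod_(i < k) x (f i)) * phi (\prod_(j < l) x (g j)).
Proof.
move=> [_ ind] xF fg i0max j0min fgn.
have k0 : (0 < k)%N by case: (i0) => i; apply: leq_ltn_trans.
have l0 : (0 < l)%N by case: (j0) => i; apply: leq_ltn_trans.
have N0 : (0 < N)%N by case: (f i0) => i; apply: leq_ltn_trans.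
rewrite (ind _ chi omega)// (ind _ (chi \o f) (omega \o f))//; last first.
  by move=> j; apply: xF.
rewrite (ind _ (chi \o g) (omega \o g))//; last by move=> j; apply: xF.
rewrite -(cut_join_max fg i0max j0min fgn) (phi_part_cut _ _ _ fg)//.
exact/mono_BI_partition/max_mono_BI_in.
Qed.

(** * Moments of words in left and right letters *)

Definition word (A : nzRingType) (K : Type) (a : K -> A) (w : seq K) : A :=
  \prod_(c <- w) a c.

Lemma word_cat (A : nzRingType) (K : Type) (a : K -> A) w1 w2 :
  word a (w1 ++ w2) = word a w1 * word a w2.
Proof. exact: big_cat. Qed.

Lemma prod_ord_words (A : nzRingType) (K : Type) k0 (a b : K -> A) n w v
    (y : nat -> A) : n = (size w + size v)%N ->
  (forall j, (j < size w)%N -> y j = a (nth k0 w j)) ->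
  (forall j, (j < size v)%N -> y (size w + j)%N = b (nth k0 v j)) ->
  \prod_(j < n) y j = word a w * word b v.
Proof.
move=> -> yw yv; rewrite big_split_ord /word !(big_nth k0) !big_mkord /=.
by congr (_ * _); apply: eq_bigr => j _; [apply: yw|apply: yv].
Qed.

(** The inequality of colours compares the two neighbours of the cut. Right positions are taken in
    decreasing order: for [k > M] the last one taken is [M + (N - k)], and for [k >= M] the first
    one left is [M + (N - k).-1]. *)
Lemma bi_boolean_std_cut (R : realType) (A : algType R[i]) (phi : {scalar A})
    (K : eqType) (F : K -> side -> classical_sets.set A) M N k
    (omega : nat -> K) (y : nat -> A) :
  bi_boolean_independent phi F ->
  (forall j, F (omega j) (if (j < M)%N then Left else Right) (y j)) ->
  (0 < k < N)%N ->
  omega (if (k <= M)%N then k.-1 else M + (N - k))%N !=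
  omega (if (k < M)%N then k else M + (N - k).-1)%N ->
  phi (\prod_(i < N) y i) =
  phi (\prod_(j < k) y (if (j < M) then j : nat else j + (N - k))%N) *
  phi (\prod_(j < N - k) y (minn M k + j)%N).
Proof.
move=> ind yF /andP[k0 kltN] pq; have kN := ltnW kltN.
have ik : ((if k <= M then k.-1 else M) < k)%N by case: ifP; lia.
have jk : ((if k < M then 0 else (N - k).-1) < N - k)%N by case: ifP; lia.
apply: (bi_boolean_cut (chi := @std_side M N) (f := cutl M kN) (g := cutr M kN)
  (omega := fun i => omega i) (x := fun i => y i)
  (i0 := Ordinal ik) (j0 := Ordinal jk) ind) => //.
- exact: std_cut.
- move=> i; rewrite -val_eqE /= => ii; have ilt := ltn_ord i.
  move: ii; rewrite /chi_lt /std_side /=; case: (leqP k M) => kM ii.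
    have iM : (i < M)%N by lia.
    have k1M : (k.-1 < M)%N by lia.
    by rewrite !(iM, k1M) /=; lia.
  rewrite ltnn /=; have MNk : (M + (N - k) < M)%N = false by lia.
  have [iM|iM] := ltnP i M; first by rewrite iM MNk.
  have iNk : (i + (N - k) < M)%N = false by lia.
  by rewrite MNk iNk; lia.
- move=> j; rewrite -val_eqE /= => jj; have jlt := ltn_ord j.
  move: jj; rewrite /chi_lt /std_side /=; case: (ltnP k M) => kM jj.
    by rewrite addn0 kM; case: ifP => // _; lia.
  by rewrite !ltnNge !leq_addr /=; lia.
- rewrite /=; apply: contra pq => /eqP E; apply/eqP; move: E.
  case: (ltngtP k M) => kM /=.
  + by rewrite ifT ?addn0//; lia.
  + by rewrite ltnn.
  + by subst k; rewrite ifT//; lia.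
Qed.

Lemma bi_boolean_words (R : realType) (A : algType R[i]) (phi : {scalar A})
    (K : eqType) (F : K -> side -> classical_sets.set A) (a b : K -> A) k0 w v k :
  bi_boolean_independent phi F ->
  (forall c, F c Left (a c)) -> (forall c, F c Right (b c)) ->
  let M := size w in let N := (M + size v)%N in let omega := nth k0 (w ++ v) in
  (0 < k < N)%N ->
  omega (if (k <= M)%N then k.-1 else M + (N - k))%N !=
  omega (if (k < M)%N then k else M + (N - k).-1)%N ->
  phi (word a w * word b v) =
  phi (word a (take k w) * word b (drop (N - k) v)) *
  phi (word a (drop k w) * word b (take (N - k) v)).
Proof.
move=> ind aF bF M N omega /andP[k0' kN] pq.
pose y p := if (p < M)%N then a (omega p) else b (omega p).
have yF j : F (omega j) (if (j < M)%N then Left else Right) (y j).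
  by rewrite /y; case: ifP.
have yw j : (j < M)%N -> y j = a (nth k0 w j).
  by move=> jM; rewrite /y jM /omega nth_cat jM.
have yv j : y (M + j)%N = b (nth k0 v j).
  by rewrite /y ltnNge leq_addr /= /omega nth_cat ltnNge leq_addr /= addKn.
have sw : size w = M by []. have sv : size v = (N - M)%N by rewrite /N addKn.
have := bi_boolean_std_cut ind yF (k := k) (N := N).
rewrite k0' kN => /(_ isT pq).
rewrite (prod_ord_words (k0 := k0) (a := a) (b := b) (w := w) (v := v))//.
move=> ->; congr (phi _ * phi _).
- apply: (prod_ord_words (k0 := k0)
    (y := fun j => y (if (j < M)%N then j else j + (N - k))%N)).
  + by rewrite size_take size_drop sw sv; case: ifP; lia.
  + move=> j; rewrite size_take_min leq_min => /andP[jk jM].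
    by rewrite nth_take// sw in jM *; rewrite jM yw.
  + move=> j; rewrite size_drop nth_drop size_take_min sw sv => jd.
    by rewrite ifN; [rewrite -yv; congr (y _); lia|lia].
- apply: (prod_ord_words (k0 := k0) (y := fun j => y (minn M k + j)%N)).
  + by rewrite size_take_min size_drop sw sv; lia.
  + move=> j; rewrite size_drop nth_drop sw => jd.
    by rewrite -yw; [congr (y _); lia|lia].
  + move=> j; rewrite size_take_min size_drop leq_min sw => /andP[jk jv].
    by rewrite nth_take// -yv; congr (y _); lia.
Qed.

Lemma bi_boolean_cut_left (R : realType) (A : algType R[i]) (phi : {scalar A})
    (K : eqType) (F : K -> side -> classical_sets.set A) (a b : K -> A) w1 c1 c2 w2 v :
  bi_boolean_independent phi F ->
  (forall c, F c Left (a c)) -> (forall c, F c Right (b c)) -> c1 != c2 ->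
  phi (word a (rcons w1 c1 ++ c2 :: w2) * word b v) =
  phi (word a (rcons w1 c1)) * phi (word a (c2 :: w2) * word b v).
Proof.
move=> ind aF bF c12; set w := _ ++ _.
have sw : size w = (size w1 + size w2).+2 by rewrite size_cat size_rcons /= addSn addnS.
rewrite (bi_boolean_words (k0 := c1) (w := w) (k := (size w1).+1) ind aF bF).
- rewrite (drop_oversize (s := v)); last by rewrite sw; lia.
  rewrite (take_oversize (s := v)); last by rewrite sw; lia.
  rewrite /w -(size_rcons w1 c1) take_size_cat// drop_size_cat//.
  by rewrite [word b [::]]big_nil mulr1.
- by rewrite sw; lia.
- rewrite !ifT ?sw; try lia.
  by rewrite /= -!catA -cats1 !nth_cat size_cat addn1 ltnn subnn ltnS leqnn /= ltnn subnn.
Qed.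

(** Since the right word is read backwards, the chi-initial part is [w] with the ending [c2 :: v2],
    which gives the length [(size w + size v2).+1] of the cut. *)
Lemma bi_boolean_cut_right (R : realType) (A : algType R[i]) (phi : {scalar A})
    (K : eqType) (F : K -> side -> classical_sets.set A) (a b : K -> A) w v1 c1 c2 v2 :
  bi_boolean_independent phi F ->
  (forall c, F c Left (a c)) -> (forall c, F c Right (b c)) -> c1 != c2 ->
  phi (word a w * word b (rcons v1 c1 ++ c2 :: v2)) =
  phi (word b (rcons v1 c1)) * phi (word a w * word b (c2 :: v2)).
Proof.
move=> ind aF bF c12; set v := _ ++ _.
have sv : size v = (size v1 + size v2).+2 by rewrite size_cat size_rcons /= addSn addnS.
have Nk : (size w + size v - (size w + size v2).+1)%N = size (rcons v1 c1).
  by rewrite size_rcons sv; lia.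
rewrite (bi_boolean_words (k0 := c1) (v := v) (k := (size w + size v2).+1) ind aF bF).
- rewrite (take_oversize (s := w)); last by lia.
  rewrite (drop_oversize (s := w)); last by lia.
  rewrite Nk /v take_size_cat// drop_size_cat//.
  by rewrite [word a [::]]big_nil mul1r mulrC.
- by rewrite sv; lia.
- rewrite !ifN; try lia.
  by rewrite Nk size_rcons /= !nth_cat !ltnNge !leq_addr /= !addKn size_rcons
    leqnn ltnn subnn /= nth_rcons ltnn eqxx eq_sym.
Qed.

(** The last letters of the two words are neighbours for the chi-order, so the cut falls between the
    two words. *)
Lemma bi_boolean_cut_middle (R : realType) (A : algType R[i]) (phi : {scalar A})
    (K : eqType) (F : K -> side -> classical_sets.set A) (a b : K -> A) w c1 v c2 :
  bi_boolean_independent phi F ->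
  (forall c, F c Left (a c)) -> (forall c, F c Right (b c)) -> c1 != c2 ->
  phi (word a (rcons w c1) * word b (rcons v c2)) =
  phi (word a (rcons w c1)) * phi (word b (rcons v c2)).
Proof.
move=> ind aF bF c12.
rewrite (bi_boolean_words (k0 := c1) (w := rcons w c1) (v := rcons v c2) (k := (size w).+1) ind aF bF).
- rewrite take_oversize ?size_rcons// drop_oversize ?size_rcons ?addKn//.
  rewrite drop_oversize ?size_rcons// take_oversize ?size_rcons//.
  by rewrite ![word _ [::]]big_nil mul1r mulr1.
- by rewrite !size_rcons; lia.
- rewrite !size_rcons leqnn ltnn addKn /= !nth_cat !size_rcons leqnn.
  by rewrite ltnNge leq_addr /= addKn !nth_rcons !ltnn !eqxx.
Qed.

(** * The ring of formal power series *)

HB.instance Definition _ (C : comNzRingType) := gen_eqMixin (ps C).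
HB.instance Definition _ (C : comNzRingType) := gen_choiceMixin (ps C).

Section PowerSeriesRing.
Variable C : comNzRingType.
Implicit Types f g h : ps C.

Definition ps0 : ps C := fun _ _ => 0.
Definition psN f : ps C := fun m n => - f m n.
Definition ps1 : ps C := fun m n => ((m == 0%N) && (n == 0%N))%:R.

Lemma psE f g : (forall m n, f m n = g m n) -> f = g.
Proof. by move=> fg; apply/funext=> m; apply/funext=> n. Qed.

Fact psDA : associative (@psD C).
Proof. by move=> f g h; apply: psE => m n; rewrite /psD addrA. Qed.

Fact psDC : commutative (@psD C).
Proof. by move=> f g; apply: psE => m n; rewrite /psD addrC. Qed.

Fact psD0 : left_id ps0 (@psD C).
Proof. by move=> f; apply: psE => m n; rewrite /psD add0r. Qed.

Fact psDN : left_inverse ps0 psN (@psD C).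
Proof. by move=> f; apply: psE => m n; rewrite /psD addNr. Qed.

HB.instance Definition _ := GRing.isZmodule.Build (ps C) psDA psDC psD0 psDN.

(* The ring axioms are inherited from polynomials agreeing with the series up
   to a given degree. *)
Definition agree N (p : {poly {poly C}}) f :=
  forall m n, (m < N)%N -> (n < N)%N -> p`_m`_n = f m n.

Definition trunc N f : {poly {poly C}} := \poly_(i < N) \poly_(j < N) f i j.

Lemma agree_trunc N f : agree N (trunc N f) f.
Proof. by move=> m n mN nN; rewrite coef_poly mN coef_poly nN. Qed.

Lemma agreeM N p q f g : agree N p f -> agree N q g -> agree N (p * q) (psM f g).
Proof.
move=> pf qg m n mN nN; rewrite coefM coef_sum; apply: eq_bigr => i _.
rewrite coefM; apply: eq_bigr => j _; rewrite pf ?qg//.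
- exact: leq_ltn_trans (leq_subr _ _) mN.
- exact: leq_ltn_trans (leq_subr _ _) nN.
- exact: leq_trans (ltn_ord i) mN.
- exact: leq_trans (ltn_ord j) nN.
Qed.

Lemma agreeD N p q f g : agree N p f -> agree N q g -> agree N (p + q) (psD f g).
Proof. by move=> pf qg m n mN nN; rewrite !coefD pf ?qg. Qed.

Lemma agree1 N : agree N 1 ps1.
Proof.
move=> m n _ _; rewrite coef1 /ps1; case: (m == 0%N); last by rewrite coef0.
by rewrite coef1.
Qed.

Lemma agree_eq f g :
  (forall N, exists p, agree N p f /\ agree N p g) -> f = g.
Proof.
move=> fg; apply: psE => m n; have [p [pf pg]] := fg (maxn m n).+1.
by rewrite -pf ?pg// ltnS ?leq_maxl ?leq_maxr.
Qed.

Fact psMA : associative (@psM C).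
Proof.
move=> f g h; apply: agree_eq => N; exists (trunc N f * trunc N g * trunc N h).
split; last by do !apply: agreeM; apply: agree_trunc.
by rewrite -mulrA; do !apply: agreeM; apply: agree_trunc.
Qed.

Fact psMC : commutative (@psM C).
Proof.
move=> f g; apply: agree_eq => N; exists (trunc N f * trunc N g).
split; last rewrite mulrC; apply: agreeM; exact: agree_trunc.
Qed.

Fact psM1 : left_id ps1 (@psM C).
Proof.
move=> f; apply: agree_eq => N; exists (1 * trunc N f); split.
  by apply: agreeM; [apply: agree1|apply: agree_trunc].
by rewrite mul1r; apply: agree_trunc.
Qed.

Fact psMD : left_distributive (@psM C) (@psD C).
Proof.
move=> f g h; apply: agree_eq => N.
exists ((trunc N f + trunc N g) * trunc N h); split.
  apply: agreeM; last exact: agree_trunc.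
  by apply: agreeD; apply: agree_trunc.
by rewrite mulrDl; apply: agreeD; apply: agreeM; apply: agree_trunc.
Qed.

Fact ps1_neq0 : ps1 != 0 :> ps C.
Proof.
apply/eqP=> /(congr1 (fun f : ps C => f 0%N 0%N)) /eqP.
by rewrite /ps1 /= oner_eq0.
Qed.

HB.instance Definition _ :=
  GRing.Zmodule_isComNzRing.Build (ps C) psMA psMC psM1 psMD ps1_neq0.

Lemma psDE f g : psD f g = f + g. Proof. by []. Qed.
Lemma psME f g : psM f g = f * g. Proof. by []. Qed.

Lemma ps_mulE f g m n :
  (f * g) m n = \sum_(i < m.+1) \sum_(j < n.+1) f i j * g (m - i)%N (n - j)%N.
Proof. by []. Qed.

Lemma ps_in_zw (p s : nat -> C) m n : (ps_in_z p * ps_in_w s) m n = p m * s n.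
Proof.
rewrite ps_mulE (bigD1 ord_max)//= (bigD1 ord0)//= !subnn subn0 /ps_in_z /ps_in_w /=.
rewrite big1 ?addr0 => [|j j0]; last by rewrite -val_eqE /= in j0; rewrite (negbTE j0) mul0r.
rewrite big1 ?addr0 // => i im; apply: big1 => j _.
suff -> : (m - i == 0)%N = false by rewrite mulr0.
by move: im; rewrite -val_eqE /=; have := ltn_ord i; lia.
Qed.

Lemma ps_in_zM (p q : nat -> C) :
  ps_in_z p * ps_in_z q = ps_in_z (fun m => \sum_(i < m.+1) p i * q (m - i)%N).
Proof.
apply: psE => m n; rewrite ps_mulE /ps_in_z.
case: eqP => [->|n0].
  by apply: eq_bigr => i _; rewrite big_ord1.
apply: big1 => i _; apply: big1 => j _.
case: eqP => [->|_]; last by rewrite mul0r.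
by rewrite subn0; case: eqP => // _; rewrite mulr0.
Qed.

Lemma ps_in_wM (p q : nat -> C) :
  ps_in_w p * ps_in_w q = ps_in_w (fun m => \sum_(i < m.+1) p i * q (m - i)%N).
Proof.
apply: psE => m n; rewrite ps_mulE /ps_in_w exchange_big /=.
case: eqP => [->|n0].
  by apply: eq_bigr => i _; rewrite big_ord1.
apply: big1 => i _; apply: big1 => j _.
case: eqP => [->|_]; last by rewrite mul0r.
by rewrite subn0; case: eqP => // _; rewrite mulr0.
Qed.

Lemma ps_in_zD (p q : nat -> C) : ps_in_z p + ps_in_z q = ps_in_z (fun m => p m + q m).
Proof. by apply: psE => m n; rewrite -psDE /psD /ps_in_z; case: eqP; rewrite ?addr0. Qed.

Lemma ps_in_wD (p q : nat -> C) : ps_in_w p + ps_in_w q = ps_in_w (fun m => p m + q m).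
Proof. by apply: psE => m n; rewrite -psDE /psD /ps_in_w; case: eqP; rewrite ?addr0. Qed.

Lemma ps_zM f m n : (psz C * f) m n = if m is m'.+1 then f m' n else 0.
Proof.
case: m => [|m]; rewrite ps_mulE /psz.
  by rewrite big_ord1 big1// => j _; rewrite mul0r.
rewrite big_ord_recl big1 ?add0r => [|j _]; last by rewrite mul0r.
rewrite big_ord_recl big_ord_recl /= mul1r subn0 subSS subn0.
rewrite big1 ?addr0 => [|j _]; last by rewrite mul0r.
by rewrite big1 ?addr0// => i _; apply: big1 => j _; rewrite mul0r.
Qed.

Lemma ps_wM f m n : (psw C * f) m n = if n is n'.+1 then f m n' else 0.
Proof.
rewrite ps_mulE /psw exchange_big /=; case: n => [|n].
  by rewrite big_ord1 big1// => j _; rewrite andbF mul0r.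
rewrite big_ord_recl big1 ?add0r => [|j _]; last by rewrite andbF mul0r.
rewrite big_ord_recl big_ord_recl /= mul1r subn0 subSS subn0.
rewrite big1 ?addr0 => [|j _]; last by rewrite mul0r.
by rewrite big1 ?addr0// => i _; apply: big1 => j _; rewrite andbF mul0r.
Qed.

Lemma psz_inj f g : psz C * f = psz C * g -> f = g.
Proof.
move=> E; apply: psE => m n; have := congr1 (fun h : ps C => h m.+1 n) E.
by rewrite !ps_zM.
Qed.

Lemma psw_inj f g : psw C * f = psw C * g -> f = g.
Proof.
move=> E; apply: psE => m n; have := congr1 (fun h : ps C => h m n.+1) E.
by rewrite !ps_wM.
Qed.

End PowerSeriesRing.

(** * Linear combinations of words sorted by their last letter *)

(* What is used of bi-Boolean independence: [beta] is [phi (u * v)], or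
   [phi (v * u)] when the two sides are exchanged. *)
Record bi_boolean_form (C : comNzRingType) (A : algType C) (K : eqType)
    (phi : {scalar A}) (beta : A -> A -> C) (a b : K -> A) : Prop := BiBooleanForm {
  form_1 : phi 1 = 1;
  form_linl : forall c u u' v, beta (c *: u + u') v = c * beta u v + beta u' v;
  form_linr : forall c u v v', beta u (c *: v + v') = c * beta u v + beta u v';
  form_1l : forall v, beta 1 v = phi v;
  form_1r : forall u, beta u 1 = phi u;
  form_cutl : forall w1 c1 c2 w2 v, c1 != c2 ->
    beta (word a (rcons w1 c1 ++ c2 :: w2)) (word b v) =
    phi (word a (rcons w1 c1)) * beta (word a (c2 :: w2)) (word b v);
  form_cutr : forall w v1 c1 c2 v2, c1 != c2 ->
    beta (word a w) (word b (rcons v1 c1 ++ c2 :: v2)) =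
    phi (word b (rcons v1 c1)) * beta (word a w) (word b (c2 :: v2));
  form_cutm : forall w c1 v c2, c1 != c2 ->
    beta (word a (rcons w c1)) (word b (rcons v c2)) =
    phi (word a (rcons w c1)) * phi (word b (rcons v c2))
}.

Lemma bi_boolean_form_sym (C : comNzRingType) (A : algType C) (K : eqType)
    (phi : {scalar A}) beta (a b : K -> A) :
  bi_boolean_form phi beta a b -> bi_boolean_form phi (fun u v => beta v u) b a.
Proof.
move=> B; split; try by case: B.
- by move=> *; rewrite (form_cutr B).
- by move=> *; rewrite (form_cutl B).
- by move=> w c1 v c2 c12; rewrite mulrC (form_cutm B) 1?eq_sym.
Qed.

Lemma bi_boolean_independent_form (R : realType) (A : algType R[i]) (phi : {scalar A})
    (K : eqType) (F : K -> side -> classical_sets.set A) (a b : K -> A) :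
  phi 1 = 1 -> bi_boolean_independent phi F ->
  (forall c, F c Left (a c)) -> (forall c, F c Right (b c)) ->
  bi_boolean_form phi (fun u v => phi (u * v)) a b.
Proof.
move=> phi1 ind aF bF; split=> //.
- by move=> c u u' v; rewrite mulrDl -scalerAl linearP.
- by move=> c u v v'; rewrite mulrDr -scalerAr linearP.
- by move=> v; rewrite mul1r.
- by move=> v; rewrite mulr1.
- move=> *; exact: (bi_boolean_cut_left _ _ _ ind).
- move=> *; exact: (bi_boolean_cut_right _ _ _ ind).
- move=> *; exact: (bi_boolean_cut_middle _ _ ind).
Qed.

(** [P] constrains the words of one expression of the element; the same element may have other
    expressions and lie in several such spans. *)
Inductive word_span (C : comNzRingType) (A : algType C) (K : eqType) (a : K -> A)
    (P : pred (seq K)) : A -> Prop :=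
| word_span0 : word_span a P 0
| word_spanS c w u : P w -> word_span a P u -> word_span a P (c *: word a w + u).

Section WordSpan.
Variables (C : comNzRingType) (A : algType C) (K : eqType) (a : K -> A).
Implicit Types (P Q : pred (seq K)) (u v : A).

Lemma word_span_word P w : P w -> word_span a P (word a w).
Proof.
by move=> Pw; have := word_spanS 1 Pw (word_span0 a P); rewrite scale1r addr0.
Qed.

Lemma word_spanD P u v : word_span a P u -> word_span a P v -> word_span a P (u + v).
Proof.
move=> + vP; elim=> [|c w u' Pw _ IH]; first by rewrite add0r.
by rewrite -addrA; apply: word_spanS.
Qed.

Lemma word_spanM P Q u c : (forall w, P w -> Q (rcons w c)) ->
  word_span a P u -> word_span a Q (u * a c).
Proof.
move=> PQ; elim=> [|x w u' Pw _ IH]; first by rewrite mul0r; apply: word_span0.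
rewrite mulrDl -scalerAl.
have -> : word a w * a c = word a (rcons w c).
  by rewrite -cats1 word_cat [word a [:: c]]big_cons big_nil mulr1.
by apply: word_spanS => //; apply: PQ.
Qed.

Lemma word_span_sub P Q u : (forall w, P w -> Q w) ->
  word_span a P u -> word_span a Q u.
Proof.
move=> PQ; elim=> [|x w u' Pw _ IH]; first exact: word_span0.
by apply: word_spanS => //; apply: PQ.
Qed.

(** Multilinear identities pass from words to spans by applying this to one argument at a time. *)
Lemma word_span_ext P (f g : A -> C) :
  (forall c u v, f (c *: u + v) = c * f u + f v) ->
  (forall c u v, g (c *: u + v) = c * g u + g v) ->
  (forall w, P w -> f (word a w) = g (word a w)) ->
  forall u, word_span a P u -> f u = g u.
Proof.
move=> fl gl fg u; have z (h : A -> C) :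
    (forall c u v, h (c *: u + v) = c * h u + h v) -> h 0 = 0.
  by move=> /(_ (-1) 0 0); rewrite scaler0 addr0 mulN1r addNr.
elim=> [|c w u' Pw _ IH]; first by rewrite !z.
by rewrite fl gl IH fg.
Qed.

Lemma word_span_prod P Q (S : pred (seq K)) u v :
  (forall w w', P w -> Q w' -> S (w ++ w')) ->
  word_span a P u -> word_span a Q v -> word_span a S (u * v).
Proof.
move=> PQ + vQ; elim=> [|x w u' Pw _ IH]; first by rewrite mul0r; apply: word_span0.
rewrite mulrDl; apply: word_spanD => //.
elim: vQ => [|y w' v' Qw' _ IH']; first by rewrite mulr0; apply: word_span0.
rewrite mulrDr; apply: word_spanD => //.
rewrite -scalerAl -scalerAr scalerA -word_cat -[_ *: _]addr0.
by apply: word_spanS; [apply: PQ|apply: word_span0].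
Qed.

Lemma word_span_sum P n (F : 'I_n -> A) :
  (forall i, word_span a P (F i)) -> word_span a P (\sum_(i < n) F i).
Proof.
move=> PF; apply: (big_ind (word_span a P)) => //; first exact: word_span0.
by move=> u v; apply: word_spanD.
Qed.

Definition ends_in (c : K) : pred (seq K) :=
  fun w => (w != [::]) && (last c w == c).

Definition not_ends_in (c : K) : pred (seq K) :=
  fun w => (w == [::]) || (last c w != c).

Definition power_of (c : K) : pred (seq K) :=
  fun w => (w != [::]) && all (pred1 c) w.

End WordSpan.

Section Form.
Variables (C : comNzRingType) (A : algType C) (K : eqType).
Variables (phi : {scalar A}) (beta : A -> A -> C) (a b : K -> A).
Hypothesis B : bi_boolean_form phi beta a b.

(** The colour changes between [w] and [l] and between [v] and [r], except after an empty prefix,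
    whose factor is [phi 1 = 1]. *)
Lemma form_words c w v l r : not_ends_in c w -> not_ends_in c v ->
  power_of c l -> power_of c r ->
  beta (word a (w ++ l)) (word b (v ++ r)) =
  phi (word a w) * phi (word b v) * beta (word a l) (word b r).
Proof.
have phi0 d : phi (word d [::]) = 1 by rewrite [word d _]big_nil (form_1 B).
move=> wc vc; case: l => [//|c' l] /andP[_ /andP[/eqP -> _]].
case: r => [//|c'' r] /andP[_ /andP[/eqP -> _]].
transitivity (phi (word a w) * beta (word a (c :: l)) (word b (v ++ c :: r))).
  case/lastP: w wc => [|w d]; first by rewrite phi0 mul1r.
  by rewrite /not_ends_in last_rcons -size_eq0 size_rcons /= => dc; rewrite (form_cutl B).
rewrite -mulrA; congr (_ * _).
case/lastP: v vc => [|v d]; first by rewrite phi0 mul1r.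
by rewrite /not_ends_in last_rcons -size_eq0 size_rcons /= => dc; rewrite (form_cutr B).
Qed.

Lemma form_words_l c w l : not_ends_in c w -> power_of c l ->
  phi (word a (w ++ l)) = phi (word a w) * phi (word a l).
Proof.
have phi0 d : phi (word d [::]) = 1 by rewrite [word d _]big_nil (form_1 B).
move=> wc; case: l => [//|c' l] /andP[_ /andP[/eqP -> _]].
case/lastP: w wc => [|w d]; first by rewrite phi0 mul1r.
rewrite /not_ends_in last_rcons -size_eq0 size_rcons /= => dc.
have phiE s : phi (word a s) = beta (word a s) (word b [::]).
  by rewrite [word b _]big_nil (form_1r B).
by rewrite phiE (form_cutl B)// -phiE.
Qed.

Lemma form_span c u v l r :
  word_span a (not_ends_in c) u -> word_span b (not_ends_in c) v ->
  word_span a (power_of c) l -> word_span b (power_of c) r ->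
  beta (u * l) (v * r) = phi u * phi v * beta l r.
Proof.
move=> + vP lP rP; move: u; apply: word_span_ext => [x u u'|x u u'|w wc].
- by rewrite mulrDl -scalerAl (form_linl B).
- by rewrite linearP /=; ring.
move: v vP; apply: word_span_ext => [x v v'|x v v'|w' w'c].
- by rewrite mulrDl -scalerAl (form_linr B).
- by rewrite linearP /=; ring.
move: l lP; apply: word_span_ext => [x l l'|x l l'|s sc].
- by rewrite mulrDr -scalerAr (form_linl B).
- by rewrite (form_linl B); ring.
move: r rP; apply: word_span_ext => [x r r'|x r r'|t tc].
- by rewrite mulrDr -scalerAr (form_linr B).
- by rewrite (form_linr B); ring.
by rewrite -!word_cat (form_words wc w'c sc tc).
Qed.

Lemma form_span_l c u l :
  word_span a (not_ends_in c) u -> word_span a (power_of c) l ->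
  phi (u * l) = phi u * phi l.
Proof.
move=> + lP; move: u; apply: word_span_ext => [x u u'|x u u'|w wc].
- by rewrite mulrDl -scalerAl linearP.
- by rewrite linearP /=; ring.
move: l lP; apply: word_span_ext => [x l l'|x l l'|s sc].
- by rewrite mulrDr -scalerAr linearP.
- by rewrite linearP /=; ring.
by rewrite -word_cat (form_words_l wc sc).
Qed.

Lemma form_span_m c1 c2 u v : c1 != c2 ->
  word_span a (ends_in c1) u -> word_span b (ends_in c2) v ->
  beta u v = phi u * phi v.
Proof.
move=> c12 + vP; move: u; apply: word_span_ext => [x u u'|x u u'|w wc].
- by rewrite (form_linl B).
- by rewrite linearP /=; ring.
move: v vP; apply: word_span_ext => [x v v'|x v v'|w' w'c].
- by rewrite (form_linr B).
- by rewrite linearP /=; ring.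
case/lastP: w wc => [//|w d]; rewrite /ends_in last_rcons => /andP[_ /eqP ->].
case/lastP: w' w'c => [//|w' d']; rewrite /ends_in last_rcons => /andP[_ /eqP ->].
exact: (form_cutm B).
Qed.

Lemma form_linD u u' v : beta (u + u') v = beta u v + beta u' v.
Proof. by rewrite -[u]scale1r (form_linl B) mul1r scale1r. Qed.

Lemma form_linDr u v v' : beta u (v + v') = beta u v + beta u v'.
Proof. by rewrite -[v]scale1r (form_linr B) mul1r scale1r. Qed.

Lemma form_0l v : beta 0 v = 0.
Proof. by have := form_linl B (-1) 0 0 v; rewrite scaler0 addr0 mulN1r addNr. Qed.

Lemma form_0r u : beta u 0 = 0.
Proof. by have := form_linr B (-1) u 0 0; rewrite scaler0 addr0 mulN1r addNr. Qed.

Lemma form_suml n (F : 'I_n -> A) v : beta (\sum_(i < n) F i) v = \sum_(i < n) beta (F i) v.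
Proof.
by apply: (big_morph (beta^~ v)) => [u u'|]; rewrite ?form_linD ?form_0l.
Qed.

Lemma form_sumr n (F : 'I_n -> A) u : beta u (\sum_(i < n) F i) = \sum_(i < n) beta u (F i).
Proof.
by apply: (big_morph (beta u)) => [v v'|]; rewrite ?form_linDr ?form_0r.
Qed.

End Form.

(** * Covariance of two series sorted by last letter *)

Definition convs (A : nzRingType) (y l : nat -> A) : nat -> A :=
  fun m => \sum_(i < m.+1) y i * l (m - i)%N.

(* A series [x] whose words are sorted by their last letter: [x0] collects the
   empty word, and the words ending in [c_k] are split as [y_k l_k] where [l_k]
   contains a nonempty final power of [c_k] that [y_k] does not prolong. *)
Record last_letter_decomposition (C : comNzRingType) (A : algType C) (K : eqType)
    (a : K -> A) (c1 c2 : K) (x : nat -> A) (x0 : nat -> C)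
    (y1 l1 y2 l2 : nat -> A) : Prop := LastLetterDecomposition {
  decE : forall m, x m = x0 m *: 1 + convs y1 l1 m + convs y2 l2 m;
  dec_y1 : forall m, word_span a (not_ends_in c1) (y1 m);
  dec_l1 : forall m, word_span a (power_of c1) (l1 m);
  dec_y2 : forall m, word_span a (not_ends_in c2) (y2 m);
  dec_l2 : forall m, word_span a (power_of c2) (l2 m)
}.

Lemma last_power_of (K : eqType) (c : K) w l : power_of c l -> last c (w ++ l) = c.
Proof.
rewrite last_cat; case/lastP: l => [//|l d] /andP[_].
by rewrite all_rcons last_rcons => /andP[/eqP].
Qed.

Lemma convs_ends_in (C : comNzRingType) (A : algType C) (K : eqType)
    (a : K -> A) c (y l : nat -> A) m :
  (forall m, word_span a (not_ends_in c) (y m)) ->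
  (forall m, word_span a (power_of c) (l m)) ->
  word_span a (ends_in c) (convs y l m).
Proof.
move=> yc lc; apply: word_span_sum => i; apply: word_span_prod (yc _) (lc _).
move=> w w' _ w'c; rewrite /ends_in last_power_of// eqxx andbT.
by case: w' w'c => // ? ? _; rewrite -size_eq0 size_cat addnS.
Qed.

Section Covariance.
Variables (C : comNzRingType) (A : algType C) (K : eqType).
Variables (phi : {scalar A}) (beta : A -> A -> C) (a b : K -> A).
Hypothesis B : bi_boolean_form phi beta a b.

Definition covariance (l r : nat -> A) : ps C :=
  fun m n => beta (l m) (r n) - phi (l m) * phi (r n).

Definition moments_z (x : nat -> A) : ps C := ps_in_z (fun m => phi (x m)).
Definition moments_w (x : nat -> A) : ps C := ps_in_w (fun m => phi (x m)).

(** Both [beta (y * l) (t * r)] and the product of the separate moments carry the prefactor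
    [phi y * phi t], which therefore comes out of their difference. *)
Lemma covariance_convs c (y l t r : nat -> A) :
  (forall m, word_span a (not_ends_in c) (y m)) ->
  (forall m, word_span a (power_of c) (l m)) ->
  (forall m, word_span b (not_ends_in c) (t m)) ->
  (forall m, word_span b (power_of c) (r m)) ->
  covariance (convs y l) (convs t r) =
  moments_z y * moments_w t * covariance l r.
Proof.
move=> yc lc tc rc; apply: psE => m n.
rewrite /covariance /convs (form_suml B) !linear_sum /= mulr_suml -sumrB.
rewrite ps_mulE; apply: eq_bigr => i _.
rewrite (form_sumr B) mulr_sumr -sumrB; apply: eq_bigr => j _.
rewrite (form_span B (c := c))// (form_span_l B (c := c))//.
rewrite (form_span_l (bi_boolean_form_sym B) (c := c))//.
by rewrite /moments_z /moments_w ps_in_zw; ring.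
Qed.

(** Scalars have zero covariance with everything, since [beta] against 1 is [phi], and the
    mixed-colour terms vanish by [form_span_m]. *)
Lemma covariance_decomposition c1 c2 x x0 y1 l1 y2 l2 s s0 t1 r1 t2 r2 :
  c1 != c2 ->
  last_letter_decomposition a c1 c2 x x0 y1 l1 y2 l2 ->
  last_letter_decomposition b c1 c2 s s0 t1 r1 t2 r2 ->
  covariance x s = moments_z y1 * moments_w t1 * covariance l1 r1 +
                   moments_z y2 * moments_w t2 * covariance l2 r2.
Proof.
move=> c12 [xE y1c l1c y2c l2c] [sE t1c r1c t2c r2c].
rewrite -(covariance_convs y1c l1c t1c r1c) -(covariance_convs y2c l2c t2c r2c).
apply: psE => m n; rewrite -psDE /psD /covariance xE sE.
have E1 := convs_ends_in m y1c l1c; have E2 := convs_ends_in m y2c l2c.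
have D1 := convs_ends_in n t1c r1c; have D2 := convs_ends_in n t2c r2c.
rewrite -!addrA !(form_linl B, form_linr B) !(form_linD B, form_linr B, form_linDr B).
rewrite !(form_1l B, form_1r B) (form_1 B).
rewrite (form_span_m B c12 E1 D2) (form_span_m B _ E2 D1) 1?eq_sym//.
rewrite !linearD !linearZ /= (form_1 B); ring.
Qed.

Lemma moments_z_convs c y l :
  (forall m, word_span a (not_ends_in c) (y m)) ->
  (forall m, word_span a (power_of c) (l m)) ->
  moments_z (convs y l) = moments_z y * moments_z l.
Proof.
move=> yc lc; rewrite /moments_z ps_in_zM; congr ps_in_z; apply/funext=> m.
rewrite linear_sum; apply: eq_bigr => i _ /=; exact: (form_span_l B (c := c)).
Qed.

Lemma moments_w_convs c y l :
  (forall m, word_span b (not_ends_in c) (y m)) ->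
  (forall m, word_span b (power_of c) (l m)) ->
  moments_w (convs y l) = moments_w y * moments_w l.
Proof.
move=> yc lc; rewrite /moments_w ps_in_wM; congr ps_in_w; apply/funext=> m.
rewrite linear_sum; apply: eq_bigr => i _ /=.
exact: (form_span_l (bi_boolean_form_sym B) (c := c)).
Qed.

End Covariance.

(** * Last-letter decompositions of the powers of a sum and of a product *)

Lemma convs_rec (A : nzRingType) (y l X : nat -> A) d :
  X 0%N = y 0%N * l 0%N ->
  (forall m, X m.+1 = X m * d + y m.+1 * l 0%N) ->
  (forall j, l j.+1 = l j * d) ->
  X = convs y l.
Proof.
move=> X0 XS lS; apply/funext=> m; rewrite /convs; elim: m => [|m IH].
  by rewrite big_ord1.
rewrite big_ord_recr /= subnn XS IH mulr_suml; congr (_ + _).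
apply: eq_bigr => i _; rewrite -mulrA -lS subSn// -ltnS; exact: ltn_ord.
Qed.

Section Decompositions.
Variables (C : comNzRingType) (A : algType C) (K : eqType) (a : K -> A).
Variables c1 c2 : K.
Hypothesis c12 : c1 != c2.

Lemma ends_in_not (c d : K) w : c != d -> ends_in c w -> not_ends_in d w.
Proof.
move=> cd; case/lastP: w => [//|w e].
by rewrite /ends_in /not_ends_in !last_rcons => /andP[_ /eqP ->]; rewrite cd orbT.
Qed.

Lemma word_span1 (P : pred (seq K)) : P [::] -> word_span a P 1.
Proof. by move=> /word_span_word -/(_ _ _ a); rewrite [word a _]big_nil. Qed.

Lemma word_span_power_of c j : word_span a (power_of c) (a c * a c ^+ j).
Proof.
elim: j => [|j IH].
  rewrite expr0 mulr1.
  have -> : a c = word a [:: c] by rewrite /word big_seq1.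
  by apply: word_span_word; rewrite /power_of /= eqxx.
rewrite exprSr mulrA; apply: word_spanM IH => w /andP[_ wc].
by rewrite /power_of -size_eq0 size_rcons all_rcons /= eqxx.
Qed.

Lemma word_span_power_of1 c j : word_span a (power_of c) (a c * (1 + a c) ^+ j).
Proof.
elim: j => [|j IH].
  by rewrite expr0 mulr1 -[a c]mulr1 -[1](expr0 (a c)); apply: word_span_power_of.
rewrite exprSr mulrA mulrDr mulr1; apply: word_spanD => //.
apply: word_spanM IH => w /andP[_ wc].
by rewrite /power_of -size_eq0 size_rcons all_rcons /= eqxx.
Qed.

Definition sum_head c m : A :=
  if m is m'.+1 then (a c1 + a c2) ^+ m' * a c else 0.

(** These are the words that may precede a final run of the other colour. The index exceeds their
    length by one because the run [a d * a d ^+ j] has index [j] and length [j.+1]. *)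
Definition sum_body c m : A :=
  if m is m'.+1 then (m' == 0%N)%:R + sum_head c m' else 0.

Lemma sum_power_span m : word_span a predT ((a c1 + a c2) ^+ m).
Proof.
elim: m => [|m IH]; first exact: word_span1.
by rewrite exprSr mulrDr; apply: word_spanD; apply: word_spanM IH.
Qed.

Lemma sum_head_span c m : word_span a (ends_in c) (sum_head c m).
Proof.
case: m => [|m]; first exact: word_span0.
apply: word_spanM (sum_power_span m) => w _.
by rewrite /ends_in last_rcons eqxx -size_eq0 size_rcons.
Qed.

Lemma sum_powerE m :
  (a c1 + a c2) ^+ m = (m == 0%N)%:R + sum_head c1 m + sum_head c2 m.
Proof. by case: m => [|m]; rewrite ?addr0// exprSr mulrDr add0r. Qed.

Lemma sum_body_span c d m : c != d -> word_span a (not_ends_in d) (sum_body c m).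
Proof.
move=> cd; case: m => [|m]; first exact: word_span0.
apply: word_spanD; last by apply: word_span_sub (sum_head_span c m) => w; apply: ends_in_not.
by case: eqP => _; [apply: word_span1|apply: word_span0].
Qed.

(** Appending the letter [c] either prolongs a final run of [c] or starts a new one after a word
    counted by [sum_body d]; this is the recursion of [convs_rec]. *)
Lemma sum_head_convs c d : (c = c1 /\ d = c2) \/ (c = c2 /\ d = c1) ->
  sum_head c = convs (sum_body d) (fun j => a c * a c ^+ j).
Proof.
move=> cd; apply: (convs_rec (d := a c)) => [|m|j]; first by rewrite mul0r.
  rewrite /= mulr1 sum_powerE -mulrDl; congr (_ * _).
  by case: cd => -[-> ->]; [rewrite addrAC addrC|rewrite addrC].
by rewrite exprSr mulrA.
Qed.

Lemma sum_decomposition :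
  last_letter_decomposition a c1 c2 (fun m => (a c1 + a c2) ^+ m)
    (fun m => (m == 0%N)%:R)
    (sum_body c2) (fun j => a c1 * a c1 ^+ j)
    (sum_body c1) (fun j => a c2 * a c2 ^+ j).
Proof.
split.
- move=> m; rewrite -!sum_head_convs; [|by right|by left].
  by rewrite sum_powerE scaler_nat.
- by move=> m; apply: sum_body_span; rewrite eq_sym.
- exact: word_span_power_of.
- by move=> m; apply: sum_body_span.
- exact: word_span_power_of.
Qed.

Let x : A := (1 + a c1) * (1 + a c2).

(** The words of [x ^+ m] ending in [c1]: if factor [i], counted from 0, supplies the last letter,
    the [i] earlier factors are free and every later choice is 1. *)
Definition prod_head1 m : A := \sum_(i < m) x ^+ i * a c1.
Definition prod_head2 m : A := x ^+ m - 1 - prod_head1 m.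
(** The index is the rank, counted from 1, of the factor where the final run starts. Before the
    [a c1] of factor [m'.+1] only [m'] factors are available, whereas its [a c2] may also follow its
    own [a c1]; hence the different offsets in the two bodies. *)
Definition prod_body1 m : A := if m is m'.+1 then 1 + prod_head2 m' else 0.
Definition prod_body2 m : A := if m is m'.+1 then 1 + prod_head1 m else 0.

Lemma prod_powerE m : x ^+ m = 1 + prod_head1 m + prod_head2 m.
Proof. by rewrite /prod_head2 -[_ - 1 - _]addrA -opprD [RHS]addrC subrK. Qed.

Lemma prod_head1S m : prod_head1 m.+1 = prod_head1 m + x ^+ m * a c1.
Proof. by rewrite /prod_head1 big_ord_recr. Qed.

Lemma prod_head2S m :
  prod_head2 m.+1 = prod_head2 m + x ^+ m * a c2 + x ^+ m * a c1 * a c2.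
Proof.
rewrite /prod_head2 prod_head1S exprSr {2}/x mulrA mulrDr mulr1 mulrDr mulr1 mulrDl.
move: (x ^+ m * a c1) (x ^+ m * a c2) (_ * a c2) => v w t.
rewrite opprD [x ^+ m + v]addrC -!addrA [LHS]addrC !addrA subrK -!addrA.
by congr (_ + _); rewrite [LHS]addrA [LHS]addrC -!addrA.
Qed.

Lemma prod_power_span m : word_span a predT (x ^+ m).
Proof.
elim: m => [|m IH]; first exact: word_span1.
rewrite exprSr /x mulrA mulrDr mulr1 mulrDr mulr1.
have IH1 : word_span a predT (x ^+ m + x ^+ m * a c1).
  by apply: word_spanD => //; apply: word_spanM IH.
by apply: word_spanD => //; apply: word_spanM IH1.
Qed.

Lemma prod_head1_span m : word_span a (ends_in c1) (prod_head1 m).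
Proof.
apply: word_span_sum => i; apply: word_spanM (prod_power_span i) => w _.
by rewrite /ends_in last_rcons eqxx -size_eq0 size_rcons.
Qed.

Lemma prod_head2_span m : word_span a (ends_in c2) (prod_head2 m).
Proof.
have last2 w : predT w -> ends_in c2 (rcons w c2).
  by rewrite /ends_in last_rcons eqxx -size_eq0 size_rcons.
elim: m => [|m IH].
  by rewrite /prod_head2 /prod_head1 big_ord0 expr0 subrr subr0; apply: word_span0.
rewrite prod_head2S; apply: word_spanD; first apply: word_spanD => //.
  exact: word_spanM last2 (prod_power_span m).
by apply: word_spanM last2 _; apply: word_spanM (prod_power_span m).
Qed.

Lemma prod_head1_convs :
  prod_head1 = convs prod_body1 (fun j => a c1 * (1 + a c1) ^+ j).
Proof.
apply: (convs_rec (d := 1 + a c1)) => [|m|j].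
- by rewrite mul0r /prod_head1 big_ord0.
- rewrite /= mulr1 prod_head1S prod_powerE mulrDr mulr1 -[RHS]addrA; congr (_ + _).
  by rewrite -mulrDl; congr (_ * _); rewrite addrAC addrC.
- by rewrite exprSr mulrA.
Qed.

Lemma prod_head2_convs :
  prod_head2 = convs prod_body2 (fun j => a c2 * (1 + a c2) ^+ j).
Proof.
apply: (convs_rec (d := 1 + a c2)) => [|m|j].
- by rewrite mul0r /prod_head2 /prod_head1 big_ord0 expr0 subrr subr0.
- rewrite /= mulr1 prod_head2S prod_head1S [in RHS]mulrDr mulr1.
  rewrite [1 + (_ + _)]addrA [(1 + _ + _) * _]mulrDl addrA; congr (_ + _).
  by rewrite -[RHS]addrA -mulrDl [_ + (1 + _)]addrC -prod_powerE.
- by rewrite exprSr mulrA.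
Qed.

(** Every power of [x] contains the empty word exactly once, so the scalar part has the series
    1/(1-z). *)
Lemma prod_decomposition :
  last_letter_decomposition a c1 c2 (fun m => x ^+ m) (fun=> 1)
    prod_body1 (fun j => a c1 * (1 + a c1) ^+ j)
    prod_body2 (fun j => a c2 * (1 + a c2) ^+ j).
Proof.
split.
- by move=> m; rewrite -prod_head1_convs -prod_head2_convs scale1r prod_powerE.
- case=> [|m]; first exact: word_span0.
  apply: word_spanD; first exact: word_span1.
  by apply: word_span_sub (prod_head2_span m) => w; apply: ends_in_not; rewrite eq_sym.
- exact: word_span_power_of1.
- case=> [|m]; first exact: word_span0.
  apply: word_spanD; first exact: word_span1.
  by apply: word_span_sub (prod_head1_span _) => w; apply: ends_in_not.
- exact: word_span_power_of1.
Qed.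

End Decompositions.

(** * The eta-transforms *)

(** Here [p] and [s] are the moment series of the product and of the sum, [h_k] and [g_k] those of
    1+a_k and b_k; [y_k], [l_k], [t_k], [r_k] come from the decompositions, [c0] is the scalar part,
    [k_k] the covariance of the runs, [n_k] the reduced eta-series, and [kap1] is eta1/z. The factor
    [z * w] stays because [k_k] is known only after multiplication by it. *)
Lemma eta_addition_algebra (S : comNzRingType)
    (z w c0 p y1 y2 l1 l2 s t1 t2 r1 r2 h1 h2 g1 g2 k1 k2 n1 n2 eta1 kap1 cov : S) :
  (1 - z) * c0 = 1 -> p = c0 + y1 * l1 + y2 * l2 ->
  y1 = z * (c0 + y2 * l2) -> y2 = c0 + y1 * l1 - 1 ->
  z * l1 = (1 - z) * h1 - 1 -> z * l2 = (1 - z) * h2 - 1 ->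
  s = 1 + t1 * r1 + t2 * r2 -> t1 = w * (1 + t2 * r2) -> t2 = w * (1 + t1 * r1) ->
  g1 = 1 + w * r1 -> g2 = 1 + w * r2 ->
  z * (w * k1) = (1 - z) * (h1 * g1 * n1) ->
  z * (w * k2) = (1 - z) * (h2 * g2 * n2) ->
  h1 * (1 - eta1) = 1 -> z * kap1 = eta1 ->
  cov = y1 * t1 * k1 + y2 * t2 * k2 ->
  z * (w * cov) = z * (w * (p * s * (n1 + kap1 * n2))).
Proof.
move=> zc0 pE y1E y2E l1E l2E sE t1E t2E g1E g2E k1E k2E h1E kapE covE.
have Y1 : y1 * ((1 - z) * h1) = z * p.
  have -> : (1 - z) * h1 = 1 + z * l1 by rewrite l1E; ring.
  by rewrite pE mulrDr mulr1 {1}y1E; ring.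
have T1 : t1 * g1 = w * s by rewrite g1E mulrDr mulr1 {1}t1E sE; ring.
have T2 : t2 * g2 = w * s by rewrite g2E mulrDr mulr1 {1}t2E sE; ring.
have P1 : (1 - z) * h1 * (c0 + y2 * l2) = p.
  have -> : (1 - z) * h1 = 1 + z * l1 by rewrite l1E; ring.
  by rewrite mulrDl mul1r pE -mulrA (mulrC l1) mulrA -y1E; ring.
have P1' : (1 - z) * (c0 + y2 * l2) = p * (1 - eta1).
  have -> : p * (1 - eta1) = (1 - z) * (c0 + y2 * l2) * (h1 * (1 - eta1)).
    by rewrite -P1; ring.
  by rewrite h1E mulr1.
(* As [(1 - z) * c0 = 1], the left-hand side is [p - (1 - z) * (c0 + y2 * l2)], which [P1'] turns
   into [p * eta1]. *)
have Y2 : y2 * ((1 - z) * h2) = z * (kap1 * p).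
  have -> : (1 - z) * h2 = 1 + z * l2 by rewrite l2E; ring.
  have -> : z * (kap1 * p) = p - p * (1 - eta1) by rewrite -kapE; ring.
  by rewrite -P1' mulrDr mulr1 (mulrDr (1 - z)) zc0 pE {1}y2E; ring.
have -> : z * (w * cov) = y1 * t1 * (z * (w * k1)) + y2 * t2 * (z * (w * k2)).
  by rewrite covE; ring.
rewrite k1E k2E.
have -> : y1 * t1 * ((1 - z) * (h1 * g1 * n1)) + y2 * t2 * ((1 - z) * (h2 * g2 * n2))
  = (y1 * ((1 - z) * h1)) * (t1 * g1) * n1 + (y2 * ((1 - z) * h2)) * (t2 * g2) * n2.
  by ring.
by rewrite Y1 Y2 T1 T2; ring.
Qed.

Section MainIdentity.
Variables (C : comNzRingType) (A : algType C) (K : eqType).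
Variables (phi : {scalar A}) (beta : A -> A -> C) (a b : K -> A).
Hypothesis B : bi_boolean_form phi beta a b.

Let pw (x : A) : nat -> A := fun m => x ^+ m.

Lemma geometric_z : (1 - psz C) * ps_in_z (fun=> 1) = 1.
Proof.
apply: psE => m n; rewrite mulrBl mul1r -psDE /psD -[(- _ : ps C) m n]/(- (_ m n)).
rewrite ps_zM /ps_in_z; case: m => [|m]; case: n => [|n]; rewrite ?subr0 ?subrr//.
Qed.

Lemma shift_z (f g : nat -> C) : f 0%N = 0 -> (forall m, f m.+1 = g m) ->
  ps_in_z f = psz C * ps_in_z g.
Proof.
move=> f0 fS; apply: psE => m n; rewrite ps_zM /ps_in_z.
by case: m => [|m]; case: n => [|n]; rewrite ?fS.
Qed.

Lemma shift_w (f g : nat -> C) : f 0%N = 0 -> (forall m, f m.+1 = g m) ->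
  ps_in_w f = psw C * ps_in_w g.
Proof.
move=> f0 fS; apply: psE => m n; rewrite ps_wM /ps_in_w.
by case: n => [|n]; case: m => [|m]; rewrite ?fS.
Qed.

Lemma psBE (f g : ps C) m n : (f - g) m n = f m n - g m n.
Proof. by []. Qed.

Lemma ps1E m n : (1 : ps C) m n = ((m == 0%N) && (n == 0%N))%:R.
Proof. by []. Qed.

(** [u * (1 + u) ^+ j] is the difference of two consecutive powers of [1 + u]; the final [- 1]
    corrects degree 0. *)
Lemma moments_z_shifted (u : A) :
  psz C * moments_z phi (fun j => u * (1 + u) ^+ j) =
  (1 - psz C) * moments_z phi (pw (1 + u)) - 1.
Proof.
rewrite mulrBl mul1r; apply: psE => m n.
rewrite !psBE !ps_zM ps1E /moments_z /ps_in_z /pw.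
case: m => [|m]; case: n => [|n] //=; rewrite ?subr0 ?expr0 ?(form_1 B) ?subrr//.
by rewrite exprS mulrDl mul1r linearD /=; ring.
Qed.

Lemma moments_w_power (v : A) :
  moments_w phi (pw v) = 1 + psw C * moments_w phi (fun j => v * v ^+ j).
Proof.
apply: psE => m n; rewrite -psDE /psD ps_wM ps1E /moments_w /ps_in_w /pw.
by case: n => [|n]; case: m => [|m] /=; rewrite ?expr0 ?(form_1 B) ?addr0 ?add0r// exprS.
Qed.

(** Differences of consecutive powers on one side and a mere shift on the other trade the covariance
    of the runs for that of the powers. Row and column 0 agree because 1 has zero covariance with
    everything. *)
Lemma covariance_shifted (u v : A) :
  psz C * (psw C * covariance phi beta (fun j => u * (1 + u) ^+ j) (fun j => v * v ^+ j)) =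
  (1 - psz C) * covariance phi beta (pw (1 + u)) (pw v).
Proof.
rewrite mulrBl mul1r; apply: psE => m n; rewrite psBE !ps_zM /covariance /pw.
case: m => [|m].
  by rewrite expr0 (form_1l B) (form_1 B) mul1r subrr subr0.
rewrite ps_wM; case: n => [|n].
  by rewrite expr0 !(form_1r B) (form_1 B) !mulr1 !subrr.
rewrite -!exprS [in RHS]exprS mulrDl mul1r (form_linD B) linearD /=; ring.
Qed.

(** [eta] and [E] are known only through their relations with moments, so the lemma also applies to
    [phi (v * u)], with a transposed series as [E]. *)
Lemma form_eta_identity c1 c2 (eta : A -> nat -> C) (E : A -> A -> ps C) :
  c1 != c2 ->
  (forall x, moments_z phi (pw x) * (1 - ps_in_z (eta x)) = 1) ->
  (forall x, moments_w phi (pw x) * (1 - ps_in_w (eta x)) = 1) ->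
  (forall x, eta x 0%N = 0) ->
  (forall x y, covariance phi beta (pw x) (pw y) =
     moments_z phi (pw x) * moments_w phi (pw y) * E x y) ->
  E ((1 + a c1) * (1 + a c2)) (b c1 + b c2) =
  E (1 + a c1) (b c1) +
  psdivz (ps_in_z (eta (1 + a c1))) * E (1 + a c2) (b c2).
Proof.
move=> c12 etaz etaw eta0 covE.
set x := _ * (1 + a c2); set s := b c1 + b c2.
have Dx := prod_decomposition a c12; have Ds := sum_decomposition b c12.
have cov := covariance_decomposition B c12 Dx Ds.
have [xE y1P l1P y2P l2P] := Dx; have [sE t1P r1P t2P r2P] := Ds.
rewrite -/x -/s in cov Dx Ds xE sE *.
have y1l1 := moments_z_convs B y1P l1P; have y2l2 := moments_z_convs B y2P l2P.
have t1r1 := moments_w_convs B t1P r1P; have t2r2 := moments_w_convs B t2P r2P.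
have phi1 := form_1 B.
have zwE : psz C * (psw C * covariance phi beta (pw x) (pw s)) =
    psz C * (psw C * (moments_z phi (pw x) * moments_w phi (pw s) *
      (E (1 + a c1) (b c1) +
       psdivz (ps_in_z (eta (1 + a c1))) * E (1 + a c2) (b c2)))).
  refine (eta_addition_algebra geometric_z _ _ _ (moments_z_shifted (a c1))
    (moments_z_shifted (a c2)) _ _ _ (moments_w_power (b c1))
    (moments_w_power (b c2)) _ _ (etaz _) _ cov).
  - rewrite -y1l1 -y2l2 /moments_z !ps_in_zD; congr ps_in_z; apply/funext=> m.
    by rewrite /pw xE !linearD linearZ /= phi1 mulr1.
  - rewrite -y2l2 -prod_head2_convs /moments_z ps_in_zD.
    by apply: shift_z => [|m]; rewrite /= ?linear0// linearD /= phi1.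
  - rewrite -y1l1 -prod_head1_convs /moments_z ps_in_zD; apply: psE => m n.
    rewrite psBE ps1E /ps_in_z; case: n => [|n]; last by rewrite andbF subr0.
    case: m => [|m] /=; last by rewrite linearD /= phi1 subr0.
    by rewrite /prod_head1 big_ord0 !linear0 addr0 subrr.
  - rewrite -t1r1 -t2r2 -!sum_head_convs; [|by right|by left].
    apply: psE => m n; rewrite -!psDE /psD ps1E /moments_w /ps_in_w /pw sum_powerE.
    case: m => [|m]; last by rewrite !addr0.
    by rewrite !linearD raddfMn /= phi1.
  - rewrite -t2r2 -sum_head_convs; last by right.
    rewrite (_ : 1 = ps_in_w (fun n => (n == 0%N)%:R)) /moments_w ?ps_in_wD.
      by apply: shift_w => [|m]; rewrite /= ?linear0// linearD raddfMn /= phi1.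
    by apply: psE => m n; rewrite ps1E /ps_in_w; case: m.
  - rewrite -t1r1 -sum_head_convs; last by left.
    rewrite (_ : 1 = ps_in_w (fun n => (n == 0%N)%:R)) /moments_w ?ps_in_wD.
      by apply: shift_w => [|m]; rewrite /= ?linear0// linearD raddfMn /= phi1.
    by apply: psE => m n; rewrite ps1E /ps_in_w; case: m.
  - by rewrite covariance_shifted covE.
  - by rewrite covariance_shifted covE.
  - by apply: psdivzK => n; rewrite /ps_in_z eta0; case: ifP.
(* Multiplication by z or w is an injective shift; the moment series of [x] and [s] are then removed
   through their inverses [1 - eta]. *)
move: zwE; rewrite covE => /psz_inj/psw_inj/(congr1 (fun f =>
  (1 - ps_in_z (eta x)) * (1 - ps_in_w (eta s)) * f)).
have cancel (f : ps C) : (1 - ps_in_z (eta x)) * (1 - ps_in_w (eta s)) *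
    (moments_z phi (pw x) * moments_w phi (pw s) * f) = f.
  transitivity ((moments_z phi (pw x) * (1 - ps_in_z (eta x))) *
    (moments_w phi (pw s) * (1 - ps_in_w (eta s))) * f); first by ring.
  by rewrite etaz etaw !mul1r.
by rewrite !cancel.
Qed.

End MainIdentity.

(** * Transposed series, and the link between moments and eta-transforms *)

Section Transposition.
Variable C : comNzRingType.

Definition ps_tr (f : ps C) : ps C := fun m n => f n m.

Lemma ps_trM (f g : ps C) : ps_tr (f * g) = ps_tr f * ps_tr g.
Proof. by apply: psE => m n; rewrite [RHS]ps_mulE exchange_big. Qed.

Lemma ps_in_z_mulE (f : nat -> C) (g : ps C) m n :
  (ps_in_z f * g) m n = \sum_(i < m.+1) f i * g (m - i)%N n.
Proof.
rewrite ps_mulE; apply: eq_bigr => i _; rewrite (bigD1 ord0)//= subn0.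
rewrite big1 ?addr0 => [//|j]; rewrite -val_eqE /= /ps_in_z => /negbTE ->.
by rewrite mul0r.
Qed.

Lemma ps_in_w_mulE (f : nat -> C) (g : ps C) m n :
  (ps_in_w f * g) m n = \sum_(i < n.+1) f i * g m (n - i)%N.
Proof.
rewrite -[LHS]/((ps_tr (ps_in_z f) * ps_tr (ps_tr g)) m n) -ps_trM.
exact: ps_in_z_mulE.
Qed.

End Transposition.

Section CumulantSeries.
Variables (R : realType) (A : algType R[i]) (phi : {scalar A}).
Hypothesis phi1 : phi 1 = 1.

Lemma moments_z_eta x :
  moments_z phi (fun m => x ^+ m) * (1 - ps_in_z (eta phi x)) = 1.
Proof.
rewrite mulrC mulrBl mul1r; apply: psE => m n.
rewrite psBE ps_in_z_mulE ps1E /moments_z /ps_in_z.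
case: n => [|n]; last first.
  by rewrite andbF big1 ?subr0// => i _; rewrite mulr0.
case: m => [|m]; first by rewrite big_ord1 expr0 phi1 /eta mul0r subr0.
rewrite big_ord_recl /= {1}/eta mul0r add0r.
(* The padding factor [x ^+ 0] acts as an empty right word in the first-block recursion. *)
rewrite -[x ^+ m.+1]mulr1 -[X in _ * X](expr0 x) (moment_first_block _ _ _ _ phi1).
rewrite big_ord0 addr0; apply/eqP; rewrite subr_eq0; apply/eqP.
by apply: eq_bigr => i _; rewrite expr0 mulr1.
Qed.

Lemma moments_w_eta x :
  moments_w phi (fun m => x ^+ m) * (1 - ps_in_w (eta phi x)) = 1.
Proof.
have := congr1 (@ps_tr R[i]) (moments_z_eta x); rewrite ps_trM.
have -> : ps_tr (1 : ps R[i]) = 1 by apply: psE => m n; rewrite /ps_tr !ps1E andbC.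
suff -> : ps_tr (1 - ps_in_z (eta phi x)) = 1 - ps_in_w (eta phi x) by [].
by apply: psE => m n; rewrite /ps_tr !psBE !ps1E andbC.
Qed.

(** With [M] the series of the mixed moments, the first-block recursion reads (1 - eta_x) M = H_y (1
    + E), where the 1 accounts for the row m = 0. Multiplying by H_x gives M = H_x H_y (1 + E). *)
Lemma covariance_eta x y :
  covariance phi (fun u v => phi (u * v)) (fun m => x ^+ m) (fun m => y ^+ m) =
  moments_z phi (fun m => x ^+ m) * moments_w phi (fun m => y ^+ m) *
    reduced_eta phi x y.
Proof.
pose M : ps R[i] := fun m n => phi (x ^+ m * y ^+ n).
set mz := moments_z _ _; set mw := moments_w _ _; set E := reduced_eta _ _ _.
have ME : (1 - ps_in_z (eta phi x)) * M = mw * (1 + E).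
  rewrite mulrBl mulrDr !mul1r mulr1; apply: psE => m n.
  rewrite psBE ps_in_z_mulE -psDE /psD ps_in_w_mulE big_ord_recl /= {1}/eta mul0r add0r.
  rewrite /mw /moments_w /ps_in_w /M.
  case: m => [|m] /=.
    by rewrite big_ord0 subr0 mul1r big1 ?addr0// => i _; rewrite mulr0.
  rewrite add0r (moment_first_block _ _ _ _ phi1) addrC addKr.
  (* The recursion is indexed by the number of [y] in the first block, the product by the number
     left over; the term with none in the block vanishes. *)
  rewrite (reindex_inj rev_ord_inj) /= big_ord_recr /= subnn mulr0 addr0.
  apply: eq_bigr => j _; have jn := ltn_ord j; rewrite [RHS]mulrC.
  have -> : (n - (n - j.+1).+1 = j)%N by lia.
  by rewrite -[(n - j)%N](subnSK jn).
have -> : covariance phi (fun u v => phi (u * v)) (fun m => x ^+ m) (fun m => y ^+ m)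
    = M - mz * mw.
  by apply: psE => m n; rewrite psBE /mz /mw ps_in_zw.
apply/eqP; rewrite subr_eq; apply/eqP.
transitivity (mz * (1 - ps_in_z (eta phi x)) * M); first by rewrite moments_z_eta mul1r.
by rewrite -mulrA ME; ring.
Qed.

End CumulantSeries.

Lemma bi_boolean_pairs_form (R : realType) (A : algType R[i]) (phi : {scalar A})
    (a1 b1 a2 b2 : A) :
  phi 1 = 1 -> bi_boolean_independent_pairs phi a1 b1 a2 b2 ->
  bi_boolean_form phi (fun u v => phi (u * v))
    (fun k : 'I_2 => if k == ord0 then a1 else a2)
    (fun k : 'I_2 => if k == ord0 then b1 else b2).
Proof.
move=> phi1 indep; apply: (bi_boolean_independent_form phi1 indep) => c S [_ aS].
  exact: aS.
exact: aS.
Qed.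

Theorem theorem4p13 (R : realType) (A : algType R[i]) (phi : {scalar A})
    (phi1 : phi 1 = 1) (a1 b1 a2 b2 : A)
    (indep : bi_boolean_independent_pairs phi a1 b1 a2 b2) :
  reduced_eta phi ((1 + a1) * (1 + a2)) (b1 + b2) =
    psD (reduced_eta phi (1 + a1) b1)
        (psM (psdivz (ps_in_z (eta phi (1 + a1))))
             (reduced_eta phi (1 + a2) b2)) /\
  reduced_eta phi (a1 + a2) ((1 + b2) * (1 + b1)) =
    psD (reduced_eta phi a2 (1 + b2))
        (psM (psdivw (ps_in_w (eta phi (1 + b2))))
             (reduced_eta phi a1 (1 + b1))).
Proof.
have B := bi_boolean_pairs_form phi1 indep.
have eta0 x : eta phi x 0%N = 0 by [].
have c12 : ord0 != lift ord0 ord0 :> 'I_2 by [].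
split.
  exact: (form_eta_identity B c12 (moments_z_eta phi1) (moments_w_eta phi1) eta0
    (covariance_eta phi1)).
have c21 : lift ord0 ord0 != ord0 :> 'I_2 by [].
(* With the sides exchanged, z marks the powers of the right variable, so the cumulant series
   appears transposed. *)
have cov x y : covariance phi (fun u v => phi (v * u)) (fun m => x ^+ m) (fun m => y ^+ m) =
    moments_z phi (fun m => x ^+ m) * moments_w phi (fun m => y ^+ m) *
      ps_tr (reduced_eta phi y x).
  rewrite [moments_z _ _ * _]mulrC.
  have := congr1 (@ps_tr R[i]) (covariance_eta phi1 y x); rewrite !ps_trM => <-.
  by apply: psE => m n; rewrite /ps_tr /covariance [phi (x ^+ m) * _]mulrC.
have := form_eta_identity (bi_boolean_form_sym B) c21 (moments_z_eta phi1)
  (moments_w_eta phi1) eta0 cov.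
move=> /(congr1 (@ps_tr R[i])) /=; rewrite [a2 + a1]addrC => H.
by rewrite [LHS]H /ps_tr psDE psME -[RHS]/(ps_tr _ + ps_tr _ * _) -ps_trM.
Qed.
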